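(* Let $G$ be a countable directed graph. Then the finite dimensional nest representations separate the points in $\mathfrak L_G$; that is, for every non-zero $A\in\mathfrak L_G$ there is a finite dimensional nest representation $\rho$ of $\mathfrak L_G$ with $\rho(A)\ne0$.
   Context: A countable directed graph $G=(\mathcal V(G),\mathcal E(G),r,s)$ consists of a countable set $\mathcal V(G)$ of vertices, a countable set $\mathcal E(G)$ of edges, and range and source maps $r,s:\mathcal E(G)\to\mathcal V(G)$. A path is a finite sequence of edges $p=e_k\cdots e_2e_1$ with $r(e_i)=s(e_{i+1})$ for $1\le i<k$; $s(p)=s(e_1)$, $r(p)=r(e_k)$. Each vertex $x$ is a path of length $0$ with $s(x)=r(x)=x$. $\mathbb F^+(G)$ is the set of all paths (including vertices); the product $pq$ is defined when $r(q)=s(p)$. Let $\mathcal H_G=\ell^2(\mathbb F^+(G))$ with orthonormal basis $\{\xi_w:w\in\mathbb F^+(G)\}$. For $p\in\mathbb F^+(G)$ let $L_p\xi_w=\xi_{pw}$ if $s(p)=r(w)$ and $L_p\xi_w=0$ otherwise. The free semigroupoid algebra $\mathfrak L_G$ is the algebra generated by $\{L_p:p\in\mathbb F^+(G)\}$, closed in the weak operator topology (WOT). A nest on a Hilbert space $\mathcal H$ is a complete chain of closed subspaces of $\mathcal H$ including $\{0\}$ and $\mathcal H$; the associated nest algebra is the algebra of all operators in $\mathcal B(\mathcal H)$ leaving every subspace of the nest invariant. A representation of $\mathfrak L_G$ is a norm-continuous algebra homomorphism $\rho:\mathfrak L_G\to\mathcal B(\mathcal H)$; it is a nest representation if $\rho(\mathfrak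 L_G)$ is a WOT-dense subalgebra of a nest algebra on $\mathcal H$. If $\dim\mathcal H<\infty$ (finite dimensional nest representation), this means $\rho$ maps onto a block upper triangular matrix algebra. *)

(* Defs.v *)
From HB Require Import structures.
From mathcomp Require Import all_boot all_order all_algebra.
From mathcomp Require Import all_classical all_reals all_analysis.
From mathcomp.analysis.showcase Require summability.
From mathcomp.real_closed Require Import complex.
From mathcomp Require Import finmap ring lra.
Set Implicit Arguments.
Unset Strict Implicit.
Unset Printing Implicit Defensive.
Import Order.TTheory GRing.Theory Num.Theory.
Import ComplexField.Normc.
Import numFieldNormedType.Exports.
Local Open Scope classical_set_scope.
Local Open Scope ring_scope.

Section SquareSummable.
Variables (R : realType) (I : choiceType).
Implicit Types f g : I -> R[i].

Definition sqsum f : \bar R := \esum_(i in setT) (normc (f i) ^+ 2)%:E.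

Definition square_summable : {pred I -> R[i]} := fun f => `[< sqsum f < +oo >]%E.

Lemma sqsum_ge0 f : (0 <= sqsum f)%E.
Proof. by apply: esum_ge0 => i _; rewrite lee_fin sqr_ge0. Qed.

Lemma sqsum_fin f : f \in square_summable -> sqsum f \is a fin_num.
Proof.
by move=> /asboolP foo; rewrite ge0_fin_numE// sqsum_ge0.
Qed.

Lemma normc_ge0 (x : R[i]) : 0 <= normc x.
Proof. by case: x => a b; rewrite sqrtr_ge0. Qed.

Lemma normcD (x y : R[i]) : normc (x + y) <= normc x + normc y.
Proof. exact: (@le_normcD _ (x : Rcomplex R) y). Qed.

Lemma sqsum_le_fin f c : (forall X : {fset I}, \sum_(i <- X) normc (f i) ^+ 2 <= c) ->
  (sqsum f <= c%:E)%E.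
Proof.
move=> H; apply: ge_ereal_sup => _ [X [finX _] <-].
by rewrite fsbig_finite//= sumEFin lee_fin.
Qed.

Lemma sqsum_ge_fin f (X : {fset I}) :
  ((\sum_(i <- X) normc (f i) ^+ 2)%:E <= sqsum f)%E.
Proof.
apply: esum_ge; exists [set` X] => //.
by rewrite fsbig_finite//= set_fsetK sumEFin.
Qed.

Lemma sqsumZ_le a f : f \in square_summable ->
  (sqsum (a *: f) <= (normc a ^+ 2)%:E * sqsum f)%E.
Proof.
move=> /sqsum_fin ffin; rewrite -(fineK ffin) -EFinM.
apply: sqsum_le_fin => X.
under eq_bigr do rewrite /= normcM exprMn.
rewrite -mulr_sumr ler_wpM2l ?sqr_ge0//.
by rewrite -lee_fin fineK// sqsum_ge_fin.
Qed.

Lemma sqsumD_le (t : R) f g : 0 < t ->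
    f \in square_summable -> g \in square_summable ->
  (sqsum (f + g)%R <= (1 + t)%:E * sqsum f + (1 + t^-1)%:E * sqsum g)%E.
Proof.
move=> t0 /sqsum_fin ffin /sqsum_fin gfin.
rewrite -(fineK ffin) -(fineK gfin) -!EFinM -EFinD.
apply: sqsum_le_fin => X.
apply: (@le_trans _ _ (\sum_(i <- X) ((1 + t) * normc (f i) ^+ 2 +
                                      (1 + t^-1) * normc (g i) ^+ 2))).
  apply: ler_sum => i _ /=.
  apply: (@le_trans _ _ ((normc (f i) + normc (g i)) ^+ 2)).
    by rewrite lerXn2r ?nnegrE ?addr_ge0 ?normc_ge0// normcD.
  rewrite -subr_ge0.
  have -> : (1 + t) * normc (f i) ^+ 2 + (1 + t^-1) * normc (g i) ^+ 2 -
      (normc (f i) + normc (g i)) ^+ 2 = t * (normc (f i) - t^-1 * normc (g i)) ^+ 2.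
    by field; rewrite gt_eqF.
  by rewrite mulr_ge0 ?sqr_ge0// ltW.
rewrite big_split/= -!mulr_sumr lerD// ler_wpM2l//.
- by rewrite addr_ge0// ltW.
- by rewrite -lee_fin fineK// sqsum_ge_fin.
- by rewrite addr_ge0// invr_ge0 ltW.
- by rewrite -lee_fin fineK// sqsum_ge_fin.
Qed.

Lemma sqsum0 : sqsum 0 = 0%E.
Proof. by apply: esum1 => i _; rewrite normc0 expr0n. Qed.

Lemma square_summable_submod : submod_closed square_summable.
Proof.
split=> [|a f g fS gS]; apply/asboolP; first by rewrite sqsum0 ltry.
have aS : a *: f \in square_summable.
  apply/asboolP/(le_lt_trans (sqsumZ_le a fS)).
  by rewrite -(fineK (sqsum_fin fS)) -EFinM ltry.
apply: le_lt_trans (sqsumD_le ltr01 aS gS) _.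
by rewrite -(fineK (sqsum_fin gS)) -(fineK (sqsum_fin aS)) -!EFinM -EFinD ltry.
Qed.

HB.instance Definition _ := GRing.isSubmodClosed.Build _ _ square_summable
  square_summable_submod.

Record ell2 := Ell2 { ell2_fun :> I -> R[i]; _ : ell2_fun \in square_summable }.

HB.instance Definition _ := [isSub for ell2_fun].
HB.instance Definition _ := [Choice of ell2 by <:].
HB.instance Definition _ := [SubChoice_isSubLmodule of ell2 by <:].

Definition ell2_norm (f : ell2) : R := Num.sqrt (fine (sqsum f)).

Lemma ell2_norm_ge0 (f : ell2) : 0 <= ell2_norm f. Proof. exact: sqrtr_ge0. Qed.

Lemma ell2_sqsum (f : ell2) : sqsum f = (ell2_norm f ^+ 2)%:E.
Proof.
rewrite sqr_sqrtr ?fineK//; first exact/sqsum_fin/valP.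
exact/fine_ge0/sqsum_ge0.
Qed.

Lemma ell2_norm_le (f : ell2) c : 0 <= c ->
  (sqsum f <= (c ^+ 2)%:E)%E -> ell2_norm f <= c.
Proof.
by move=> c0; rewrite ell2_sqsum lee_fin ler_sqr ?nnegrE ?ell2_norm_ge0.
Qed.

Lemma ell2_coord_le (f : ell2) i : normc (f i) <= ell2_norm f.
Proof.
rewrite -ler_sqr ?nnegrE ?normc_ge0 ?ell2_norm_ge0// -lee_fin -ell2_sqsum.
by have := sqsum_ge_fin f [fset i]%fset; rewrite big_seq_fset1.
Qed.

Lemma ell2_norm_eq0 (f : ell2) : ell2_norm f = 0 -> f = 0.
Proof.
move=> f0; apply/val_inj/funext => i /=.
by apply: eq0_normc; apply/eqP; rewrite eq_le normc_ge0 -f0 ell2_coord_le.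
Qed.

Lemma ell2_normZ_le (a : R[i]) (f : ell2) :
  ell2_norm (a *: f) <= normc a * ell2_norm f.
Proof.
apply: ell2_norm_le; first by rewrite mulr_ge0 ?normc_ge0 ?ell2_norm_ge0.
by rewrite exprMn EFinM -ell2_sqsum; apply: sqsumZ_le; exact: valP.
Qed.

Lemma ell2_normZ (a : R[i]) (f : ell2) :
  ell2_norm (a *: f) = normc a * ell2_norm f.
Proof.
apply/eqP; rewrite eq_le ell2_normZ_le/=.
have [->|a0] := eqVneq a 0; first by rewrite normc0 mul0r ell2_norm_ge0.
have na0 : 0 < normc a.
  by rewrite lt_neqAle normc_ge0 andbT eq_sym; apply: contra_neq a0 => /eq0_normc.
rewrite mulrC -ler_pdivlMr// mulrC -normcV.
by have := ell2_normZ_le a^-1 (a *: f); rewrite scalerA mulVf// scale1r.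
Qed.

Lemma ell2_normD (f g : ell2) : ell2_norm (f + g) <= ell2_norm f + ell2_norm g.
Proof.
have [f0|f0] := eqVneq (ell2_norm f) 0.
  by rewrite f0 (ell2_norm_eq0 f0) !add0r.
have [g0|g0] := eqVneq (ell2_norm g) 0.
  by rewrite g0 (ell2_norm_eq0 g0) !addr0.
apply: ell2_norm_le; first by rewrite addr_ge0 ?ell2_norm_ge0.
have t0 : 0 < ell2_norm g / ell2_norm f.
  by rewrite divr_gt0// lt_neqAle eq_sym ?f0 ?g0 ell2_norm_ge0.
apply: le_trans (sqsumD_le t0 (valP f) (valP g)) _.
rewrite !ell2_sqsum -!EFinM -EFinD lee_fin le_eqVlt; apply/orP; left; apply/eqP.
by field; rewrite f0 g0.
Qed.

Let normC (f : ell2) : R[i] := (ell2_norm f)%:C%C.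

Let normCD (f g : ell2) : normC (f + g) <= normC f + normC g.
Proof. by rewrite -rmorphD lecR ell2_normD. Qed.

Let normCZ (a : R[i]) (f : ell2) : normC (a *: f) = `|a| * normC f.
Proof. by rewrite /normC ell2_normZ rmorphM. Qed.

Let normC_eq0 (f : ell2) : normC f = 0 -> f = 0.
Proof. by move=> [] /ell2_norm_eq0. Qed.

HB.instance Definition _ := Lmodule_isNormed.Build R[i] ell2 normCD normCZ normC_eq0.

Lemma ell2_normE (f : ell2) : `|f| = (ell2_norm f)%:C%C. Proof. by []. Qed.

End SquareSummable.

Section Hilbert.
Variables (R : realType) (I : choiceType).
Local Notation H := (ell2 R I).

Lemma basis_subproof (i : I) :
  (fun j => (j == i)%:R : R[i]) \in square_summable (R := R) (I := I).
Proof.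
apply/asboolP; apply: (@le_lt_trans _ _ 1%:E); last exact: ltry.
apply: sqsum_le_fin => X.
apply: (@le_trans _ _ (\sum_(j <- X | j == i) (1 : R))).
  rewrite [leRHS]big_mkcond/=; apply: ler_sum => j _.
  by case: eqP => _; rewrite ?normc1 ?normc0 ?expr1n ?expr0n.
by rewrite big_const_seq count_uniq_mem ?fset_uniq//; case: (i \in _); rewrite /= ?addr0.
Qed.

Definition basis (i : I) : H := Ell2 (basis_subproof i).

(* The inner product is an unconditional sum: a limit along the net of finite
   subsets of I. *)
Definition inner (f g : H) : R[i]^o :=
  summability.sum (fun i => f i * (g i)^*%C : R[i]^o).

Lemma inner_basis (f : H) (i : I) : inner f (basis i) = f i.
Proof.
apply: cvg_lim; first exact: norm_hausdorff.
  exact: summability.totally_filter.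
apply: (@cvg_near_cst _ _ _ _ _ (@filter_filter _ _ summability.totally_filter)).
exists [fset i]%fset => //= X; rewrite /= fsub1set => iX.
rewrite /summability.partial_sum.
rewrite (bigD1 [` iX]%fset)//= eqxx conjc1 mulr1 big1 ?addr0//.
move=> j ji; rewrite (_ : (val j == i) = false) ?conjc0 ?mulr0//.
by apply/negbTE; apply: contra ji => /eqP ji; apply/eqP/val_inj.
Qed.

End Hilbert.

Section BoundedOperators.
Variables (R : realType) (I : choiceType).
Local Notation H := (ell2 R I).

Definition bounded_operator : {pred H -> H} := fun T =>
  `[< linear T /\ exists M : R, forall x, ell2_norm (T x) <= M * ell2_norm x >].

Lemma bounded_operator_submod : submod_closed bounded_operator.
Proof.
split=> [|a S T /asboolP[Sl [M SM]] /asboolP[Tl [N TN]]]; apply/asboolP.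
  split=> [a x y|]; first by rewrite /= scaler0 addr0.
  by exists 0 => x; rewrite mul0r /ell2_norm sqsum0 fine0 sqrtr0.
split=> [b x y|].
  rewrite [LHS](_ : _ = a *: S (b *: x + y) + T (b *: x + y))//.
  rewrite Sl Tl /= !scalerDr !scalerA [in LHS](mulrC a b).
  by rewrite addrACA.
exists (normc a * M + N) => x.
apply: (le_trans (ell2_normD (a *: S x) (T x))).
by rewrite ell2_normZ mulrDl lerD// -mulrA ler_wpM2l ?normc_ge0.
Qed.

HB.instance Definition _ := GRing.isSubmodClosed.Build _ _ bounded_operator
  bounded_operator_submod.

Record bop := Bop { bop_fun :> H -> H; _ : bop_fun \in bounded_operator }.

HB.instance Definition _ := [isSub for bop_fun].
HB.instance Definition _ := [Choice of bop by <:].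
HB.instance Definition _ := [SubChoice_isSubLmodule of bop by <:].

Lemma bop_linear (T : bop) : linear T.
Proof. by case: T => T /= /asboolP[]. Qed.

Lemma bop_bounded (T : bop) :
  exists M : R, forall x, ell2_norm (T x) <= M * ell2_norm x.
Proof. by case: T => T /= /asboolP[]. Qed.

HB.instance Definition _ (T : bop) := GRing.isLinear.Build R[i] H H _ T (bop_linear T).

Lemma bopD (S T : bop) x : (S + T) x = S x + T x. Proof. by []. Qed.

Lemma bopZ a (T : bop) x : (a *: T) x = a *: T x. Proof. by []. Qed.

Lemma bop_comp_subproof (S T : bop) : (S \o T) \in bounded_operator.
Proof.
apply/asboolP; split=> [a x y /=|]; first by rewrite !linearP.
have [M SM] := bop_bounded S; have [N TN] := bop_bounded T.
exists (Num.max M 0 * N) => x /=; rewrite -mulrA.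
apply: le_trans (ler_wpM2l _ (TN x)); last by rewrite le_max lexx orbT.
by apply: (le_trans (SM _)); rewrite ler_wpM2r ?ell2_norm_ge0// le_max lexx.
Qed.

Definition bop_comp (S T : bop) : bop := Bop (bop_comp_subproof S T).

Definition opnorm (T : bop) : R :=
  sup [set ell2_norm (T x) | x in [set x | ell2_norm x <= 1]].

Let opnorm_has_sup (T : bop) :
  has_sup [set ell2_norm (T x) | x in [set x | ell2_norm x <= 1]].
Proof.
split; first by exists (ell2_norm (T 0)), 0 => //=; rewrite /ell2_norm sqsum0 fine0 sqrtr0.
have [M TM] := bop_bounded T.
exists (Num.max M 0) => _ [x /= x1 <-].
apply: (le_trans (TM x)); apply: (@le_trans _ _ (Num.max M 0 * ell2_norm x)).
  by rewrite ler_wpM2r ?ell2_norm_ge0// le_max lexx.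
by rewrite ler_piMr// le_max lexx orbT.
Qed.

Lemma opnorm_ub (T : bop) x : ell2_norm x <= 1 -> ell2_norm (T x) <= opnorm T.
Proof. by move=> x1; apply: sup_upper_bound => //; exists x. Qed.

Lemma opnorm_ge0 (T : bop) : 0 <= opnorm T.
Proof.
apply: le_trans (opnorm_ub T (x := 0) _); first exact: ell2_norm_ge0.
by rewrite /ell2_norm sqsum0 fine0 sqrtr0.
Qed.

Lemma opnorm_lub (T : bop) c :
  (forall x, ell2_norm x <= 1 -> ell2_norm (T x) <= c) -> opnorm T <= c.
Proof.
move=> Tc; apply: ge_sup; first by case: (opnorm_has_sup T).
by move=> _ [x x1 <-]; exact: Tc.
Qed.

Lemma opnormP (T : bop) x : ell2_norm (T x) <= opnorm T * ell2_norm x.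
Proof.
have [x0|x0] := eqVneq (ell2_norm x) 0.
  by rewrite (ell2_norm_eq0 x0) linear0 /ell2_norm sqsum0 fine0 sqrtr0 mulr0.
have xp : 0 < ell2_norm x by rewrite lt_neqAle eq_sym x0 ell2_norm_ge0.
have normcR (r : R) : 0 <= r -> normc (r%:C%C) = r.
  by move=> r0; rewrite /= expr0n/= addr0 sqrtr_sqr ger0_norm.
have := @opnorm_ub T ((ell2_norm x)^-1%:C%C *: x).
rewrite linearZ !ell2_normZ normcR ?invr_ge0 ?ell2_norm_ge0// mulVf// => /(_ (lexx _)).
by rewrite mulrC ler_pdivrMr.
Qed.

Lemma opnormD (S T : bop) : opnorm (S + T) <= opnorm S + opnorm T.
Proof.
apply: opnorm_lub => x x1.
by rewrite bopD; apply: (le_trans (ell2_normD (S x) (T x))); apply: lerD; exact: opnorm_ub.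
Qed.

Lemma opnormZ (a : R[i]) (T : bop) : opnorm (a *: T) = normc a * opnorm T.
Proof.
have le b (S : bop) : opnorm (b *: S) <= normc b * opnorm S.
  apply: opnorm_lub => x x1.
  by rewrite bopZ ell2_normZ ler_wpM2l ?normc_ge0//; exact: opnorm_ub.
apply/eqP; rewrite eq_le le/=.
have [->|a0] := eqVneq a 0; first by rewrite normc0 mul0r opnorm_ge0.
have na0 : 0 < normc a.
  by rewrite lt_neqAle normc_ge0 andbT eq_sym; apply: contra_neq a0 => /eq0_normc.
rewrite mulrC -ler_pdivlMr// mulrC -normcV.
by have := le a^-1 (a *: T); rewrite scalerA mulVf// scale1r.
Qed.

Lemma opnorm_eq0 (T : bop) : opnorm T = 0 -> T = 0.
Proof.
move=> T0; apply/val_inj/funext => x /=; apply: ell2_norm_eq0; apply/eqP.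
by rewrite eq_le ell2_norm_ge0 andbT; have := opnormP T x; rewrite T0 mul0r.
Qed.

Let normC (T : bop) : R[i] := (opnorm T)%:C%C.

Let normCD (S T : bop) : normC (S + T) <= normC S + normC T.
Proof. by rewrite -rmorphD lecR opnormD. Qed.

Let normCZ (a : R[i]) (T : bop) : normC (a *: T) = `|a| * normC T.
Proof. by rewrite /normC opnormZ rmorphM. Qed.

Let normC_eq0 (T : bop) : normC T = 0 -> T = 0.
Proof. by move=> [] /opnorm_eq0. Qed.

HB.instance Definition _ := Lmodule_isNormed.Build R[i] bop normCD normCZ normC_eq0.

Lemma opnormE (T : bop) : `|T| = (opnorm T)%:C%C. Proof. by []. Qed.

Definition subalgebra (A : set bop) : Prop :=
  [/\ A 0, forall a S T, A S -> A T -> A (a *: S + T) &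
      forall S T, A S -> A T -> A (bop_comp S T)].

Definition generated_algebra (X : set bop) : set bop := smallest subalgebra X.

(* The weak operator topology is the initial topology for the map sending T to
   the family of its coefficients (inner (T x) y), indexed by pairs (x, y). *)
Definition coefficients (T : bop) : {ptws H * H -> R[i]^o} :=
  fun xy => inner (T xy.1) xy.2.

Definition wot_closure (A : set bop) : set bop :=
  @closure (initial_topology coefficients) A.

Definition subspace (M : set H) : Prop :=
  M 0 /\ forall a x y, M x -> M y -> M (a *: x + y).

Definition closed_subspace (M : set H) : Prop := closed M /\ subspace M.

(* Completeness is closure under arbitrary intersections and closed spans; the
   empty family yields H and {0}. *)
Definition nest (N : set (set H)) : Prop :=
  [/\ N `<=` closed_subspace, N [set 0], N setT,
      forall M M', N M -> N M' -> M `<=` M' \/ M' `<=` M &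
      forall F, F `<=` N ->
        N (\bigcap_(M in F) M) /\
        N (smallest closed_subspace (\bigcup_(M in F) M))].

Definition nest_algebra (N : set (set H)) : set bop :=
  [set T | forall M, N M -> T @` M `<=` M].

End BoundedOperators.

Section Representations.
Variables (R : realType) (I J : choiceType).

(* Only the values of rho on L matter; elsewhere rho is arbitrary. *)
Definition representation (L : set (bop R I)) (rho : bop R I -> bop R J) : Prop :=
  [/\ {within L, continuous rho},
      forall a S T, L S -> L T -> rho (a *: S + T) = a *: rho S + rho T &
      forall S T, L S -> L T -> rho (bop_comp S T) = bop_comp (rho S) (rho T)].

(* The Hilbert space of the representation is ell2 R J; it is finite dimensional,
   namely C^n, for J = 'I_n. *)
Definition nest_representation (L : set (bop R I)) (rho : bop R I -> bop R J) :=
  representation L rho /\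
  exists2 N, nest N & rho @` L `<=` nest_algebra N /\
                      nest_algebra N `<=` wot_closure (rho @` L).

End Representations.

Record digraph := Digraph {
  vertex : countType;
  edge : countType;
  range_of : edge -> vertex;
  source_of : edge -> vertex
}.

Section Paths.
Variable G : digraph.

(* The edges are listed in the order of traversal, so that the path written
   e_k ... e_2 e_1 in function-composition order is [:: e_1; e_2; ...; e_k]. *)
Fixpoint walk (x : vertex G) (es : seq (edge G)) : bool :=
  if es is e :: es' then (source_of e == x) && walk (range_of e) es' else true.

(* The initial vertex is stored in order to have one path of length 0 at each
   vertex. *)
Record gpath := GPath {
  gpath_val : vertex G * seq (edge G);
  _ : walk gpath_val.1 gpath_val.2
}.

HB.instance Definition _ := [isSub for gpath_val].
HB.instance Definition _ := [Countable of gpath by <:].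

Definition psource (p : gpath) : vertex G := (val p).1.
Definition pedges (p : gpath) : seq (edge G) := (val p).2.
Definition prange (p : gpath) : vertex G :=
  last (psource p) (map (@range_of G) (pedges p)).

Lemma walk_cat x es es' :
  walk x (es ++ es') = walk x es && walk (last x (map (@range_of G) es)) es'.
Proof. by elim: es x => //= e es IH x; rewrite IH andbA. Qed.

(* The product pq traverses q first; it is defined when prange q = psource p. *)
Lemma pmul_subproof (p q : gpath) : prange q = psource p ->
  walk (psource q) (pedges q ++ pedges p).
Proof. by move=> qp; rewrite walk_cat -/(prange q) qp (valP q) (valP p). Qed.

Definition pmul (p q : gpath) (qp : prange q = psource p) : gpath :=
  @GPath (psource q, pedges q ++ pedges p) (pmul_subproof qp).

(* The path w with v = p w, if there is one. *)
Definition lquot (p v : gpath) : option gpath :=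
  let es := take (size (pedges v) - size (pedges p)) (pedges v) in
  obind (fun w => if (prange w == psource p) && (pedges v == es ++ pedges p)
                  then Some w else None)
        (insub (psource v, es)).

Lemma lquotP (p v w : gpath) :
  lquot p v = Some w <-> exists qp : prange w = psource p, v = pmul qp.
Proof.
rewrite /lquot; set es := take _ _; split.
  case: insubP => [u _ uE|//] /=; case: ifP => // /andP[/eqP ru /eqP vE] [<-{w}].
  have [u1 u2] : psource u = psource v /\ pedges u = es by rewrite /psource /pedges uE.
  by exists ru; apply: val_inj; rewrite /= u1 u2 -vE; exact: surjective_pairing.
case=> qp vE.
have esE : es = pedges w.
  by rewrite /es vE /pedges/= size_cat addnK take_size_cat.
have svE : psource v = psource w by rewrite vE.
case: insubP => [u _ uE|]; last by rewrite esE svE (valP w).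
have -> : u = w by apply: val_inj; rewrite uE esE svE /pedges /psource; case: (val w).
by rewrite /= qp eqxx/= esE vE /pedges/= eqxx.
Qed.

End Paths.

Section FreeSemigroupoidAlgebra.
Variables (R : realType) (G : digraph).
Local Notation H := (ell2 R (gpath G)).

Definition creation_fun (p : gpath G) (f : gpath G -> R[i]) (v : gpath G) : R[i] :=
  oapp f 0 (lquot p v).

Lemma creation_fun_sqsum (p : gpath G) f :
  (sqsum (creation_fun p f) <= sqsum f)%E.
Proof.
rewrite /sqsum /creation_fun.
pose D := [set v | isSome (lquot p v)].
rewrite [leLHS](_ : _ = \esum_(v in D) (normc (oapp f 0 (lquot p v)) ^+ 2)%:E).
  pose e v := odflt v (lquot p v).
  rewrite [leLHS](_ : _ = \esum_(v in D) (normc (f (e v)) ^+ 2)%:E); last first.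
    by apply: eq_esum => v; rewrite /D /e /=; case: (lquot p v).
  rewrite -(esum_image D e (fun w => (normc (f w) ^+ 2)%:E)); last first.
    move=> v1 v2 /set_mem d1 /set_mem d2; move: d1 d2; rewrite /D /e /=.
    case E1 : (lquot p v1) => [w1|//] _; case E2 : (lquot p v2) => [w2|//] _ /= w12.
    have [q1 ->] := (lquotP p v1 w1).1 E1; have [q2 ->] := (lquotP p v2 w2).1 E2.
    by apply: val_inj; rewrite /= w12.
  rewrite [leLHS]esum_mkcond; apply: le_esum => w _.
  by case: ifP => _ //; rewrite lee_fin sqr_ge0.
rewrite [RHS]esum_mkcond; apply: eq_esum => v _; rewrite /D.
case: ifPn => //; rewrite notin_setE/=.
by case: (lquot p v) => [w []//|_]; rewrite -[oapp _ _ _]/(0 : R[i]) normc0 expr0n.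
Qed.

Lemma creation_fun_summable (p : gpath G) (f : H) :
  creation_fun p f \in square_summable (R := R) (I := gpath G).
Proof.
apply/asboolP; apply: le_lt_trans (creation_fun_sqsum p f) _.
by rewrite ell2_sqsum ltry.
Qed.

Lemma creation_subproof (p : gpath G) :
  (fun f : H => Ell2 (creation_fun_summable p f)) \in
    bounded_operator (R := R) (I := gpath G).
Proof.
apply/asboolP; split=> [a f g|].
  apply/val_inj/funext => v; rewrite /= /creation_fun.
  rewrite [RHS](_ : _ = a * oapp f 0 (lquot p v) + oapp g 0 (lquot p v))//.
  by case: (lquot p v) => //=; rewrite mulr0 addr0.
exists 1 => f; rewrite mul1r; apply: ell2_norm_le; first exact: ell2_norm_ge0.
by rewrite -ell2_sqsum; exact: creation_fun_sqsum.
Qed.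

(* The operator L_p; it is determined by creation_basis and creation_basis0. *)
Definition creation (p : gpath G) : bop R (gpath G) := Bop (creation_subproof p).

Lemma creation_basis (p w : gpath G) (qp : prange w = psource p) :
  creation p (basis R w) = basis R (pmul qp).
Proof.
apply/val_inj/funext => v; rewrite /= /creation_fun.
have [->|vw] := eqVneq v (pmul qp).
  by rewrite ((lquotP _ _ w).2 (ex_intro _ qp erefl))/= eqxx.
case E : (lquot p v) => [u|] //=; case: eqVneq => // uw.
have [q vE] := (lquotP p v u).1 E; case/eqP: vw.
by rewrite vE; apply: val_inj; rewrite /= uw.
Qed.

Lemma creation_basis0 (p w : gpath G) : prange w <> psource p ->
  creation p (basis R w) = 0.
Proof.
move=> qp; apply/val_inj/funext => v; rewrite /= /creation_fun.
case E : (lquot p v) => [u|] //=; case: eqVneq => // uw.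
by have [q _] := (lquotP p v u).1 E; case: qp; rewrite -uw.
Qed.

Definition free_semigroupoid_algebra : set (bop R (gpath G)) :=
  wot_closure (generated_algebra (range creation)).

End FreeSemigroupoidAlgebra.

Arguments free_semigroupoid_algebra R G : clear implicits.

(* Main.v *)
Require Import Defs.
From mathcomp Require Import all_boot all_order all_algebra.
From mathcomp Require Import all_classical all_reals all_analysis.
From HB Require Import structures.
From mathcomp.real_closed Require Import complex.
From mathcomp Require Import finmap ring lra.
Set Implicit Arguments.
Unset Strict Implicit.
Unset Printing Implicit Defensive.
Import Order.TTheory GRing.Theory Num.Theory.
Import ComplexField.Normc.
Import numFieldNormedType.Exports.
Local Open Scope ring_scope.

(** An operator T of the free semigroupoid algebra acts by left convolution
    with its Fourier coefficients a(x, w), the coordinate at the path w starting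
    at x of the image under T of the basis vector at the vertex x.  This holds
    for the creation operators, is preserved by sums and products, and passes to
    the closure because, at a fixed vector and a fixed coordinate, both sides
    are weakly continuous in T ([free_semigroupoid_algebra_convolver]).  Hence a
    nonzero T has a nonzero coefficient, and every functional of coefficients
    that turns convolution into matrix multiplication is a representation.

    Such functionals come from finite weighted automata: states lie over
    vertices, transitions are labelled by edges, and [transfer i j a] is the sum
    over all runs from i to j of the weight of the run times the value of a at
    the word read.  When the weights leaving a state add up to at most 1/4, the
    sums converge, depend boundedly on T, and the unfolding of a run at its
    first transition makes them multiplicative ([transfer_convolution]).  The
    matrices obtained leave invariant the spans of the sets of states closed
    under transitions.  They fill the whole nest algebra when two conditions
    hold: for each state there is a word that, among the states over the same
    vertex, can be read only from that state, and it leads back to it, so that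
    the creation operator of the word becomes a nonzero multiple of a diagonal
    matrix unit; and of two states one always reaches the other, so that the
    invariant sets form a chain
    ([realizes_matrix], [automaton_rep_nest_representation]).

    It remains to find, for a word es with a(es) <> 0, such an automaton with a
    nonzero transfer ([nonvanishing_automaton]).  Cut es at its last vertex from
    which the starting vertex x can be reached.  The initial segment extends to
    a closed walk at x; repeat it forever and let d be the least period of the
    resulting sequence of edges.  A cycle of d states (one state without
    transitions, if the walk is empty) reads this sequence, and the minimality
    of d is what makes the words read from different states different.  (For a
    path running several times around a single loop this gives one state, as it
    must, the algebra of a loop being commutative.)  The next edge of es leads
    to an automaton for the remaining word, given by induction; no vertex occurs
    on both sides of this edge, by the choice of the cut, and therefore the two
    conditions survive ([graft]).

    Runs may turn around the cycle any number of times before leaving it, so the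
    transfer is a power series in the weight t of the transitions of the cycle,
    whose coefficients are, up to a constant, transfers of the remaining
    automaton (values of a, if es ends in the cycle).  The one coming from es is
    nonzero, so there is a first nonzero one, and its term dominates all later ones
    when t is small ([cycle_nonvanishing]). *)

Local Notation basis := Defs.basis.

(** * Sequences with geometrically small increments *)
Section GeometricLimits.
Variable R : realType.
Local Notation C := R[i].
Implicit Types (u v : nat -> C) (l : C).

Lemma normc_real (r : R) : 0 <= r -> normc (r%:C%C) = r.
Proof. by move=> r0; rewrite /= expr0n/= addr0 sqrtr_sqr ger0_norm. Qed.

Lemma normc_sum (J : Type) (s : seq J) (f : J -> C) :
  normc (\sum_(i <- s) f i) <= \sum_(i <- s) normc (f i).
Proof.
elim: s => [|i s IH]; first by rewrite !big_nil normc0.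
by rewrite !big_cons (le_trans (normcD _ _))// lerD2l.
Qed.

Lemma geometric_eq0 (x c : R) : 0 <= x -> (forall n, x <= c / 2 ^+ n) -> x = 0.
Proof.
move=> x0 xc; apply/eqP; rewrite eq_le x0 andbT leNgt; apply/negP => xp.
have c0 : 0 < c by have := xc 0%N; rewrite expr0 divr1; apply: lt_le_trans.
have [n cn] : exists n : nat, c / x < n%:R.
  by exists (Num.truncn (c / x)).+1; rewrite truncnS_gt.
have n2 : n%:R <= 2 ^+ n :> R by rewrite -natrX ler_nat ltnW// ltn_expl.
have := xc n; rewrite ler_pdivlMr ?exprn_gt0// leNgt => /negP; apply.
by rewrite mulrC -ltr_pdivrMr//; apply: lt_le_trans n2.
Qed.

(** Subtracting and adding the tail 2c/2^n to the n-th term gives a nondecreasing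
    and a nonincreasing sequence; the supremum of the former lies between them. *)
Lemma real_geometric_limit (u : nat -> R) (c : R) :
    (forall n, `|u n.+1 - u n| <= c / 2 ^+ n) ->
  exists m : R, forall n, `|u n - m| <= 2 * c / 2 ^+ n.
Proof.
move=> uc.
have c0 : 0 <= c.
  by have := uc 0%N; rewrite expr0 divr1; apply: le_trans.
pose e n := 2 * c / 2 ^+ n.
have eS n : e n.+1 + c / 2 ^+ n = e n.
  by rewrite /e exprS; field; rewrite expf_neq0.
pose v n := u n - e n; pose w n := u n + e n.
have e0 n : 0 <= e n by rewrite /e divr_ge0 ?exprn_ge0 ?mulr_ge0.
have vS n : v n <= v n.+1.
  by have := uc n; have := eS n; rewrite ler_norml /v => <- /andP[]; lra.
have wS n : w n.+1 <= w n.
  by have := uc n; have := eS n; rewrite ler_norml /w => <- /andP[]; lra.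
have vw n m : v n <= w m.
  have vk k : v n <= v (n + k)%N.
    by elim: k => [|k IH]; rewrite ?addn0// addnS (le_trans IH).
  have wk k : w (m + k)%N <= w m.
    by elim: k => [|k IH]; rewrite ?addn0// addnS (le_trans (wS _)).
  apply: le_trans (vk m) _; apply: le_trans (wk n); rewrite addnC /v /w.
  by have := e0 (m + n)%N; lra.
exists (sup (range v)) => n; rewrite -/(e n).
have hv : has_sup (range v).
  by split; [exists (v 0%N), 0%N | exists (w 0%N) => _ [k _ <-]].
have : v n <= sup (range v) by apply: sup_upper_bound => //; exists n.
have : sup (range v) <= w n by apply: ge_sup; [case: hv|move=> _ [k _ <-]].
by rewrite /v /w ler_norml => ? ?; apply/andP; split; lra.
Qed.

(** The rate 1/2 is built in: it is the rate at which all the sums over runs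
    below converge, and it makes both uniqueness and the passage through sums
    and shifts elementary. *)
Definition geometric_lim u l := exists c : R, forall n, normc (u n - l) <= c / 2 ^+ n.

Lemma geometric_lim_unique u l l' : geometric_lim u l -> geometric_lim u l' -> l = l'.
Proof.
move=> [c uc] [c' uc']; apply/eqP; rewrite -subr_eq0; apply/eqP/eq0_normc.
apply: (@geometric_eq0 _ (c + c')); first exact: normc_ge0.
move=> n; rewrite mulrDl (le_trans _ (lerD (uc n) (uc' n)))//.
rewrite (_ : l - l' = - (u n - l) + (u n - l')); last by ring.
by apply: le_trans (normcD _ _) _; rewrite normcN.
Qed.

Lemma geometric_lim_cst l : geometric_lim (fun=> l) l.
Proof. by exists 0 => n; rewrite subrr normc0 mul0r. Qed.

Lemma geometric_limD u v l m : geometric_lim u l -> geometric_lim v m ->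
  geometric_lim (fun n => u n + v n) (l + m).
Proof.
move=> [c uc] [d vd]; exists (c + d) => n; rewrite mulrDl.
rewrite (_ : _ - _ = (u n - l) + (v n - m)); last by ring.
by apply: le_trans (normcD _ _) _; rewrite lerD.
Qed.

Lemma geometric_limZ a u l : geometric_lim u l -> geometric_lim (fun n => a * u n) (a * l).
Proof.
move=> [c uc]; exists (normc a * c) => n.
by rewrite -mulrBr normcM -mulrA ler_wpM2l ?normc_ge0.
Qed.

Lemma geometric_lim_sum (J : Type) (s : seq J) (f : J -> nat -> C) (l : J -> C) :
    (forall i, geometric_lim (f i) (l i)) ->
  geometric_lim (fun n => \sum_(i <- s) f i n) (\sum_(i <- s) l i).
Proof.
move=> fl; elim: s => [|i s IH].
  by under eq_fun do rewrite big_nil; rewrite big_nil; exact: geometric_lim_cst.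
by under eq_fun do rewrite big_cons; rewrite big_cons; apply: geometric_limD.
Qed.

Lemma geometric_limS u l : geometric_lim u l -> geometric_lim (fun n => u n.+1) l.
Proof.
move=> [c uc]; exists c => n; apply: le_trans (uc _) _.
have c0 : 0 <= c.
  by have := uc 0%N; rewrite expr0 divr1; apply: le_trans; rewrite normc_ge0.
rewrite ler_wpM2l// lef_pV2 ?posrE ?exprn_gt0//.
by rewrite exprS ler_peMl ?exprn_ge0// ler1n.
Qed.

Lemma normc_Re (x : C) : `|complex.Re x| <= normc x.
Proof.
case: x => a b /=; rewrite -sqrtr_sqr ler_wsqrtr//.
by rewrite lerDl sqr_ge0.
Qed.

Lemma normc_Im (x : C) : `|complex.Im x| <= normc x.
Proof.
case: x => a b /=; rewrite -sqrtr_sqr ler_wsqrtr//.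
by rewrite lerDr sqr_ge0.
Qed.

Lemma normc_le_ReIm (x : C) : normc x <= `|complex.Re x| + `|complex.Im x|.
Proof.
case: x => a b /=; rewrite -[leRHS]ger0_norm ?addr_ge0// -sqrtr_sqr ler_wsqrtr//.
rewrite sqrrD !real_normK ?num_real// lerD2r lerDl mulrn_wge0 ?mulr_ge0//.
Qed.

Lemma geometric_limit u (c : R) :
    (forall n, normc (u n.+1 - u n) <= c / 2 ^+ n) ->
  exists2 l, geometric_lim u l & forall n, normc (u n - l) <= 4 * c / 2 ^+ n.
Proof.
move=> uc.
have [n|x xP] := @real_geometric_limit (fun n => complex.Re (u n)) c.
  by rewrite (le_trans _ (uc n))// -raddfB normc_Re.
have [n|y yP] := @real_geometric_limit (fun n => complex.Im (u n)) c.
  by rewrite (le_trans _ (uc n))// -raddfB normc_Im.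
have lP n : normc (u n - Complex x y) <= 4 * c / 2 ^+ n.
  apply: le_trans (normc_le_ReIm _) _.
  rewrite !raddfB /= (_ : 4 * c / _ = 2 * c / 2 ^+ n + 2 * c / 2 ^+ n).
    by rewrite lerD.
  by rewrite -!mulrDl; congr (_ * _ / _); lra.
by exists (Complex x y) => //; exists (4 * c).
Qed.

End GeometricLimits.

(** * Convolution of coefficients *)
Section Convolution.
Variables (R : realType) (G : digraph).
Local Notation C := R[i].
Local Notation word := (seq (edge G)).
Implicit Types (x y : vertex G) (e : edge G) (s : word).
Implicit Types (a b : vertex G -> word -> C) (c d : word -> C).

(** The sum over all factorizations of s into a first part, weighted by c, and a
    remaining part, weighted by a at the vertex where the first part ends; x is
    the vertex where s starts.  The recursion peels off the first edge of the
    first part, the form in which runs of an automaton are unfolded. *)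
Fixpoint convolution a x c s : C :=
  a x s * c [::] +
  if s is e :: s' then convolution a (range_of e) (fun r => c (e :: r)) s' else 0.

Lemma convolution_linear a x (k : C) c d s :
  convolution a x (fun r => k * c r + d r) s = k * convolution a x c s + convolution a x d s.
Proof.
elim: s x c d => [|e s IH] x c d /=; first by ring.
by rewrite IH; ring.
Qed.

Lemma convolution_linearl a b x (k : C) c s :
  convolution (fun y r => k * a y r + b y r) x c s = k * convolution a x c s + convolution b x c s.
Proof.
elim: s x c => [|e s IH] x c /=; first by ring.
by rewrite IH; ring.
Qed.

Lemma convolutionA a b x c s :
  convolution a x (convolution b x c) s = convolution (fun y => convolution a y (b y)) x c s.
Proof.
elim: s x c => [|e s IH] x c /=; first by ring.
rewrite !addr0 mulrDl mulrA -!addrA; congr (_ + _).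
rewrite -IH -[_ * c [::]]mulrC -convolution_linear; congr (convolution _ _ _ _).
by apply/funext => r; rewrite mulrC.
Qed.

Lemma convolution0 a x s : convolution a x (fun=> 0) s = 0.
Proof. by elim: s x => [|e s IH] x /=; rewrite mulr0 ?add0r ?IH ?addr0. Qed.

Lemma convolution0l a x c s : (forall y r, a y r = 0) -> convolution a x c s = 0.
Proof. by move=> a0; elim: s x c => [|e s IH] x c /=; rewrite a0 mul0r ?add0r ?IH ?addr0. Qed.

Lemma convolution_nonwalk a x c s :
    (forall y r, ~~ walk y r -> a y r = 0) -> (forall r, ~~ walk x r -> c r = 0) ->
  ~~ walk x s -> convolution a x c s = 0.
Proof.
move=> a0; elim: s x c => [|e s IH] x c c0 //= xs.
rewrite a0 // mul0r add0r; have [ex|ex] := boolP (source_of e == x).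
  by apply: IH => [r er|]; [apply: c0 => /=; rewrite (negbTE er) andbF|move: xs; rewrite ex].
rewrite (_ : (fun r => c (e :: r)) = fun=> 0) ?convolution0//.
by apply/funext => r; apply: c0; rewrite /= (negbTE ex).
Qed.

(** There are size s + 1 factorizations, and n + 1 <= 2^n: bounded families
    convolve to families of growth 2^n. *)
Lemma convolution_bound a x c s (A B : R) : 0 <= B ->
    (forall y r, normc (a y r) <= A) -> (forall r, normc (c r) <= B) ->
  normc (convolution a x c s) <= A * B * 2 ^+ size s.
Proof.
move=> B0 aA cB.
have A0 : 0 <= A by apply: le_trans (aA x [::]); rewrite normc_ge0.
suff H : normc (convolution a x c s) <= A * B * (size s).+1%:R.
  apply: le_trans H _; rewrite ler_wpM2l ?mulr_ge0// -natrX ler_nat.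
  exact: ltn_expl.
elim: s x c cB => [|e s IH] x c cB /=.
  by rewrite addr0 mulr1 normcM ler_pM ?normc_ge0.
apply: le_trans (normcD _ _) _.
rewrite -[(size s).+2]addn1 natrD mulrDr mulr1 addrC lerD//; first by apply: IH.
by rewrite normcM ler_pM ?normc_ge0.
Qed.

Definition path_delta x0 s0 x s : C := ((x == x0) && (s == s0))%:R.

Lemma convolution_path_delta_short x0 s0 x c s : (size s < size s0)%N ->
  convolution (path_delta x0 s0) x c s = 0.
Proof.
elim: s x c => [|e s IH] x c /= ss0.
  by rewrite /path_delta; case: (s0) ss0 => // e r _; rewrite andbF mul0r addr0.
rewrite IH ?(ltnW ss0)// addr0 /path_delta.
case: (_ :: _ =P s0) ss0 => [<-|]; by rewrite ?ltnn ?andbF ?mul0r.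
Qed.

Lemma convolution_path_delta_cat x0 s0 x c u :
  convolution (path_delta x0 s0) x c (u ++ s0) =
  (last x (map (@range_of G) u) == x0)%:R * c u.
Proof.
elim: u x c => [|e u IH] x c /=.
  have E : convolution (path_delta x0 s0) x c s0 = path_delta x0 s0 x s0 * c [::].
    case: s0 => [|e s] /=; first by rewrite addr0.
    by rewrite convolution_path_delta_short// addr0.
  by rewrite E /path_delta eqxx andbT.
rewrite IH /path_delta.
case: (_ :: _ =P s0) => [E|]; last by rewrite andbF mul0r add0r.
by have := congr1 size E; rewrite /= size_cat => /eqP; rewrite -addSn -[X in _ == X]add0n eqn_add2r.
Qed.

Lemma convolution_path_delta_notin x0 s0 x c s :
    (forall u, s = u ++ s0 -> last x (map (@range_of G) u) <> x0) ->
  convolution (path_delta x0 s0) x c s = 0.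
Proof.
elim: s x c => [|e s IH] x c us /=; rewrite /path_delta.
  case: (_ =P s0) => [E|]; last by rewrite andbF mul0r addr0.
  by have /= /eqP/negbTE -> := us [::] E; rewrite mul0r addr0.
rewrite IH => [|u su]; last exact: (us (e :: u) (congr1 (cons e) su)).
case: (_ =P s0) => [E|]; last by rewrite andbF mul0r addr0.
by have /= /eqP/negbTE -> := us [::] E; rewrite mul0r addr0.
Qed.

End Convolution.

(** * Elements of the algebra are convolution operators *)
Section FourierCoefficients.
Variables (R : realType) (G : digraph).
Local Notation C := R[i].
Local Notation H := (ell2 R (gpath G)).
Implicit Types (x y : vertex G) (e : edge G) (s : seq (edge G)).
Implicit Types (f g : H) (T S : bop R (gpath G)).

(** Extending by 0 to sequences of edges that are not walks spares every
    recursion on words the proof that they are composable. *)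
Definition word_coord f x s : C := oapp f 0 (insub (x, s) : option (gpath G)).

Definition vertex_path x : gpath G := @GPath G (x, [::]) isT.

Definition fourier T x s : C := word_coord (T (basis R (vertex_path x))) x s.

Lemma word_coord_path f (p : gpath G) : word_coord f (psource p) (pedges p) = f p.
Proof.
by rewrite /word_coord /psource /pedges -surjective_pairing valK.
Qed.

Lemma word_coord_nonwalk f x s : ~~ walk x s -> word_coord f x s = 0.
Proof. by move=> xs; rewrite /word_coord insubN. Qed.

Lemma fourier_nonwalk T x s : ~~ walk x s -> fourier T x s = 0.
Proof. exact: word_coord_nonwalk. Qed.

Lemma word_coord_linear (k : C) f g x s :
  word_coord (k *: f + g) x s = k * word_coord f x s + word_coord g x s.
Proof. by rewrite /word_coord; case: insubP => //= _; rewrite mulr0 addr0. Qed.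

Lemma fourier_linear (k : C) S T x s :
  fourier (k *: S + T) x s = k * fourier S x s + fourier T x s.
Proof. exact: word_coord_linear. Qed.

Lemma word_coord_bound f x s : normc (word_coord f x s) <= ell2_norm f.
Proof.
rewrite /word_coord; case: insubP => [p _ _|_]; first exact: ell2_coord_le.
by rewrite -[oapp _ _ _]/(0 : R[i]) normc0 ell2_norm_ge0.
Qed.

Lemma basis_norm (I : choiceType) (i : I) : ell2_norm (basis R i) <= 1.
Proof.
apply: ell2_norm_le => //; apply: sqsum_le_fin => X.
apply: (@le_trans _ _ (\sum_(j <- X | j == i) (1 : R))).
  rewrite [leRHS]big_mkcond/=; apply: ler_sum => j _.
  by case: eqP => _; rewrite ?normc1 ?normc0 ?expr1n ?expr0n.
rewrite expr1n big_const_seq count_uniq_mem ?fset_uniq//.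
by case: (i \in _); rewrite /= ?addr0.
Qed.

Lemma fourier_bound T x s : normc (fourier T x s) <= opnorm T.
Proof.
by apply: le_trans (word_coord_bound _ _ _) _; apply: opnorm_ub; exact: basis_norm.
Qed.

Definition convolver T := forall f x s,
  word_coord (T f) x s = convolution (fourier T) x (word_coord f x) s.

Lemma convolver_comp S T : convolver S -> convolver T ->
  forall x s, fourier (bop_comp S T) x s = convolution (fourier S) x (fourier T x) s.
Proof. by move=> cS cT x s; rewrite /fourier /= cS. Qed.

(** Closure under products is the associativity of convolution. *)
Lemma convolver_subalgebra : subalgebra convolver.
Proof.
split=> [f x s|k S T cS cT f x s|S T cS cT f x s].
- rewrite convolution0l => [|y r]; rewrite /fourier /word_coord; by case: insubP.
- rewrite word_coord_linear cS cT -convolution_linearl.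
  by congr (convolution _ _ _ _); apply/funext => y; apply/funext => r; rewrite fourier_linear.
- rewrite /= cS (_ : word_coord (T f) x = convolution (fourier T) x (word_coord f x)).
    rewrite convolutionA; congr (convolution _ _ _ _); apply/funext => y; apply/funext => r.
    by rewrite convolver_comp.
  by apply/funext => r; rewrite cT.
Qed.

Lemma fourier_creation (p : gpath G) x s :
  fourier (creation R p) x s = path_delta R (psource p) (pedges p) x s.
Proof.
rewrite /fourier; have [xs|xs] := boolP (walk x s); last first.
  rewrite word_coord_nonwalk// /path_delta.
  case: eqP => //= xp; case: eqP => //= sp.
  by move: xs; rewrite xp sp (valP p).
have -> : word_coord (creation R p (basis R (vertex_path x))) x s =
    creation R p (basis R (vertex_path x)) (@GPath G (x, s) xs).
  by rewrite -word_coord_path.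
rewrite /path_delta; have [xp|xp] := eqVneq x (psource p); last first.
  by rewrite creation_basis0//; exact/eqP.
rewrite (@creation_basis _ _ p (vertex_path x) xp) /=.
by rewrite -val_eqE /= xpair_eqE /= eqxx.
Qed.

Lemma convolver_creation (p : gpath G) : convolver (creation R p).
Proof.
move=> f x s.
rewrite (_ : fourier _ = path_delta R (psource p) (pedges p)); last first.
  by apply/funext => y; apply/funext => r; exact: fourier_creation.
have [xs|xs] := boolP (walk x s); last first.
  rewrite word_coord_nonwalk// convolution_nonwalk// => [y r yr|r].
    by rewrite -fourier_creation fourier_nonwalk.
  exact: word_coord_nonwalk.
pose v := @GPath G (x, s) xs.
have -> : word_coord (creation R p f) x s = oapp f 0 (lquot p v).
  exact: (word_coord_path (creation R p f) v).
case E : (lquot p v) => [w|] /=.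
  have [rw vE] := (lquotP _ _ _).1 E.
  have [-> ->] : x = psource w /\ s = pedges w ++ pedges p.
    by have := congr1 val vE => /= -[].
  by rewrite convolution_path_delta_cat -/(prange w) rw eqxx mul1r word_coord_path.
rewrite convolution_path_delta_notin// => u su lu.
have xu : walk x u by have := xs; rewrite su walk_cat => /andP[].
have : lquot p v = Some (@GPath G (x, u) xu).
  by apply/lquotP; exists lu; apply: val_inj; rewrite /= su.
by rewrite E.
Qed.

Lemma convolver_generated T :
  generated_algebra (range (@creation R G)) T -> convolver T.
Proof.
apply => /=; split; first exact: convolver_subalgebra.
by move=> _ [p _ <-]; exact: convolver_creation.
Qed.

Local Notation W := (initial_topology (@coefficients R (gpath G))).

(** A composite of the map defining the topology and of a projection of the
    product. *)
Lemma wot_continuous_inner f g :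
  continuous (fun T : W => inner (T f) g : C^o).
Proof.
have ic : continuous (@coefficients R (gpath G) : W -> {ptws H * H -> C^o}).
  exact: initial_continuous.
have pc : continuous (fun h : {ptws H * H -> C^o} => h (f, g)).
  exact: (@proj_continuous _ (fun=> C^o) (f, g)).
by move=> T; exact: (@continuous_comp _ _ _ _ _ T (ic T) (pc _)).
Qed.

Lemma wot_continuous_coord f x s :
  continuous (fun T : W => word_coord (T f) x s : C^o).
Proof.
rewrite /word_coord; case: insubP => [p _ _|_] /=; last exact: cst_continuous.
rewrite (_ : (fun T : W => T f p) = (fun T : W => inner (T f) (basis R p))); last first.
  by apply/funext => T; rewrite inner_basis.
exact: wot_continuous_inner.
Qed.

Lemma continuous_mulr (X : topologicalType) (phi : X -> C^o) (k : C) :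
  continuous phi -> continuous (fun t => phi t * k : C^o).
Proof.
move=> pc; rewrite (_ : (fun t => _) = (fun t => k *: phi t)); last first.
  by apply/funext => t; rewrite mulrC.
by move=> t; exact: (cvgZr (pc t)).
Qed.

Lemma continuous_add (X : topologicalType) (phi psi : X -> C^o) :
  continuous phi -> continuous psi -> continuous (fun t => phi t + psi t : C^o).
Proof. by move=> pc qc t; exact: (cvgD (pc t) (qc t)). Qed.

Lemma continuous_sub (X : topologicalType) (phi psi : X -> C^o) :
  continuous phi -> continuous psi -> continuous (fun t => phi t - psi t : C^o).
Proof. by move=> pc qc t; exact: (cvgB (pc t) (qc t)). Qed.

Lemma wot_continuous_conv x c s :
  continuous (fun T : W => convolution (fourier T) x c s : C^o).
Proof.
elim: s x c => [|e s IH] x c /=.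
  apply: continuous_add; last exact: cst_continuous.
  by apply: continuous_mulr; exact: wot_continuous_coord.
apply: continuous_add; last exact: IH.
by apply: continuous_mulr; exact: wot_continuous_coord.
Qed.

(** For fixed f, x and s the defining identity equates two weakly continuous
    functions of T, so it passes from the generated algebra to its closure. *)
Lemma free_semigroupoid_algebra_convolver T : free_semigroupoid_algebra R G T -> convolver T.
Proof.
move=> LT f x s; apply/eqP; rewrite -subr_eq0; apply/eqP.
pose phi (S : W) : C^o := word_coord (S f) x s - convolution (fourier S) x (word_coord f x) s.
have phic : continuous phi.
  by apply: continuous_sub; [exact: wot_continuous_coord|exact: wot_continuous_conv].
have cl : closed (phi @^-1` [set 0])%classic.
  apply: closed_comp => [S _|]; first exact: phic.
  by apply: accessible_closed_set1; apply: hausdorff_accessible; exact: norm_hausdorff.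
apply: cl; apply: closure_subset LT => S gS /=.
by rewrite /phi convolver_generated// subrr.
Qed.

Lemma generated_sub_free_semigroupoid_algebra : (generated_algebra (range (@creation R G)) `<=`
  free_semigroupoid_algebra R G)%classic.
Proof. exact: (@subset_closure W). Qed.

Lemma exists_fourier_neq0 T : free_semigroupoid_algebra R G T -> T <> 0 ->
  exists x s, walk x s /\ fourier T x s <> 0.
Proof.
move=> /free_semigroupoid_algebra_convolver cT T0; apply: contrapT => nT; apply: T0.
have f0 x s : fourier T x s = 0.
  have [xs|xs] := boolP (walk x s); last exact: fourier_nonwalk.
  by apply: contrapT => fT; apply: nT; exists x, s.
apply/val_inj/funext => f; apply/val_inj/funext => p /=.
by rewrite -word_coord_path cT convolution0l.
Qed.

End FourierCoefficients.

(** * Weighted automata and sums over runs *)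
Section Transfer.
Variables (R : realType) (G : digraph).
Local Notation C := R[i].
Local Notation word := (seq (edge G)).

Record automaton := Automaton {
  state : finType;
  vert : state -> vertex G;
  step : state -> state -> option (edge G);
  weight : state -> state -> R
}.

Definition edge_shift (o : option (edge G)) (a : word -> C) : word -> C :=
  fun s => if o is Some e then a (e :: s) else 0.

(** The sum over the runs with fewer than n transitions. *)
Fixpoint partial (M : automaton) n (i j : state M) (a : word -> C) : C :=
  if n is m.+1 then
    (i == j)%:R * a [::] +
    \sum_(l : state M) (weight i l)%:C%C * partial m l j (edge_shift (step i l) a)
  else 0.

(** Exponential growth has to be allowed: convolutions of bounded families need
    not be bounded.  The base 2 against row sums at most 1/4 leaves the
    contraction factor 1/2. *)
Definition growth (c : R) (a : word -> C) :=
  forall s, normc (a s) <= c * 2 ^+ size s.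

Definition transfer (M : automaton) (i j : state M) (a : word -> C) : C :=
  xget 0 [set l | geometric_lim (fun n => partial n i j a) l]%classic.

Definition contractive (M : automaton) := forall i : state M,
  (forall l, 0 <= weight i l) /\ \sum_(l : state M) weight i l <= 4^-1.

Definition weight_positive (M : automaton) :=
  forall i l : state M, step i l <> None -> 0 < weight i l.

Lemma growth_ge0 c a : growth c a -> 0 <= c.
Proof. by move=> /(_ [::]); rewrite mulr1; apply: le_trans; exact: normc_ge0. Qed.

Lemma growth_bounded c a : (forall s, normc (a s) <= c) -> growth c a.
Proof.
move=> ac s; apply: le_trans (ac s) _; rewrite ler_peMr//.
  by apply: le_trans (ac [::]); exact: normc_ge0.
by rewrite -natrX ler1n expn_gt0.
Qed.

Lemma edge_shift_bounded c o a : (forall s, normc (a s) <= c) ->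
  forall s, normc (edge_shift o a s) <= c.
Proof.
move=> ac s; case: o => [e|]; first exact: ac.
by rewrite -[edge_shift _ _ _]/(0 : C) normc0 (le_trans _ (ac [::]))// normc_ge0.
Qed.

Lemma growth_edge_shift c o a : growth c a -> growth (2 * c) (edge_shift o a).
Proof.
move=> ac s; case: o => [e|].
  by apply: le_trans (ac (e :: s)) _; rewrite /= exprS mulrCA mulrA.
rewrite -[edge_shift _ _ _]/(0 : C) normc0 !mulr_ge0 ?exprn_ge0//.
exact: growth_ge0 ac.
Qed.

Lemma edge_shiftD o (k : C) a b s :
  edge_shift o (fun r => k * a r + b r) s = k * edge_shift o a s + edge_shift o b s.
Proof. by case: o => //=; rewrite mulr0 addr0. Qed.

Lemma growthD c d (k : C) a b : growth c a -> growth d b ->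
  growth (normc k * c + d) (fun r => k * a r + b r).
Proof.
move=> ac bd s; apply: le_trans (normcD _ _) _.
by rewrite mulrDl lerD// normcM -mulrA ler_wpM2l ?normc_ge0.
Qed.

Lemma contraction_sum (M : automaton) (i : state M) (c : R) (f : state M -> C) :
    contractive M -> (forall l, normc (f l) <= c) ->
  normc (\sum_l (weight i l)%:C%C * f l) <= c / 4.
Proof.
move=> /(_ i)[w0 w4] fc; apply: le_trans (normc_sum _ _) _.
have c0 : 0 <= c by apply: le_trans (fc i); exact: normc_ge0.
apply: (@le_trans _ _ (\sum_l weight i l * c)).
  by apply: ler_sum => l _; rewrite normcM normc_real// ler_wpM2l.
by rewrite -mulr_suml mulrC ler_wpM2l.
Qed.

Section ContractiveAutomaton.
Variable M : automaton.
Hypothesis Mc : contractive M.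
Implicit Types (i j l : state M) (a b : word -> C).

Lemma partialS n i j a : partial n.+1 i j a = (i == j)%:R * a [::] +
  \sum_l (weight i l)%:C%C * partial n l j (edge_shift (step i l) a).
Proof. by []. Qed.

(** Each transition multiplies the growth constant by 2 and the sum by at most
    1/4. *)
Lemma partial_step n i j c a : growth c a ->
  normc (partial n.+1 i j a - partial n i j a) <= c / 2 ^+ n.
Proof.
elim: n i c a => [|n IH] i c a ac.
  rewrite /= subr0 big1 => [|l _]; last by rewrite mulr0.
  rewrite addr0 expr0 divr1 normcM.
  have := ac [::]; rewrite mulr1; case: eqP => _; rewrite ?normc1 ?mul1r//.
  by rewrite normc0 mul0r => _; exact: growth_ge0 ac.
rewrite !(partialS _ i) opprD addrACA subrr add0r -sumrB.
under eq_bigr do rewrite -mulrBr.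
have -> : c / 2 ^+ n.+1 = 2 * c / 2 ^+ n / 4.
  by rewrite exprS; field; rewrite expf_neq0.
apply: contraction_sum => // l; apply: IH; exact: growth_edge_shift.
Qed.

Lemma transferP i j c a : growth c a ->
  geometric_lim (fun n => partial n i j a) (transfer i j a) /\
  normc (transfer i j a) <= 4 * c.
Proof.
move=> ac; have [l al lb] := geometric_limit (fun n => partial_step n i j ac).
have -> : transfer i j a = l.
  by rewrite /transfer; case: xgetP => [m _ /geometric_lim_unique|/(_ l)] => [/(_ _ al)|].
split=> //; have := lb 0%N.
by rewrite /= sub0r normcN expr0 divr1.
Qed.

Lemma transfer_lim i j c a z : growth c a -> geometric_lim (fun n => partial n i j a) z ->
  transfer i j a = z.
Proof. by move=> /(transferP i j)[az _] /(geometric_lim_unique az). Qed.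

Lemma transfer_bound i j c a : growth c a -> normc (transfer i j a) <= 4 * c.
Proof. by move=> /(transferP i j)[]. Qed.

(** Unfolding a run at its first transition. *)
Lemma transfer_unfold i j c a : growth c a ->
  transfer i j a = (i == j)%:R * a [::] +
    \sum_l (weight i l)%:C%C * transfer l j (edge_shift (step i l) a).
Proof.
move=> ac; apply: geometric_lim_unique (geometric_limS (transferP i j ac).1) _ => /=.
apply: geometric_limD; first exact: geometric_lim_cst.
apply: geometric_lim_sum => l; apply: geometric_limZ.
by case: (transferP l j (growth_edge_shift (step i l) ac)).
Qed.

Lemma partial_linear n i j (k : C) a b :
  partial n i j (fun s => k * a s + b s) = k * partial n i j a + partial n i j b.
Proof.
elim: n i a b => [|n IH] i a b /=; first by rewrite mulr0 addr0.
under eq_bigr => l _.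
  rewrite (_ : edge_shift _ _ = (fun s => k * edge_shift (step i l) a s + edge_shift (step i l) b s)).
    by rewrite IH mulrDr (mulrCA _ k); over.
  by apply/funext => s; exact: edge_shiftD.
by rewrite big_split /= -mulr_sumr; ring.
Qed.

Lemma transfer_linear i j (k : C) c d a b : growth c a -> growth d b ->
  transfer i j (fun s => k * a s + b s) = k * transfer i j a + transfer i j b.
Proof.
move=> ac bd; apply: transfer_lim (growthD k ac bd) _.
under eq_fun do rewrite partial_linear.
by apply: geometric_limD; [apply: geometric_limZ|]; [case: (transferP i j ac)|case: (transferP i j bd)].
Qed.

Lemma transfer0 i j a : (forall s, a s = 0) -> transfer i j a = 0.
Proof.
move=> a0; have a0g : growth 0 a.
  by move=> s; rewrite a0 normc0 mul0r.
by apply: eq0_normc; apply/eqP; rewrite eq_le normc_ge0 andbT -[leRHS](mulr0 4) transfer_bound.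
Qed.

(** Consecutive transitions read composable edges, and the word read from a state
    is a walk starting at the vertex below it. *)
Definition compatible := forall i l e, step i l = Some e ->
  source_of e = vert i /\ range_of e = vert l.

Hypothesis Mv : compatible.

(** Unfolding both sides at the first transition shows that their difference
    [D i b], as a function of b, satisfies the homogeneous equation
    [D i b = \sum_l weight i l * D l (edge_shift (step i l) b)].  Edge shifts do not
    increase the bound on b, so row sums at most 1/4 force the difference to
    vanish. *)
Lemma transfer_convolution i j (a : vertex G -> word -> C) b (A B : R) :
    (forall y s, normc (a y s) <= A) -> (forall s, normc (b s) <= B) ->
  transfer i j (convolution a (vert i) b) =
  \sum_l transfer i l b * transfer l j (a (vert l)).
Proof.
move=> aA bB.
pose D i b := transfer i j (convolution a (vert i) b) -
  \sum_l transfer i l b * transfer l j (a (vert l)).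
have B0 : 0 <= B by apply: le_trans (bB [::]); exact: normc_ge0.
have cg x (d : word -> C) : (forall s, normc (d s) <= B) -> growth (A * B) (convolution a x d).
  by move=> dB s; apply: convolution_bound.
have ag y : growth A (a y) by apply: growth_bounded.
have D_unfold i' (d : word -> C) : (forall s, normc (d s) <= B) ->
    D i' d = \sum_l (weight i' l)%:C%C * D l (edge_shift (step i' l) d).
  move=> dB; have dg : growth B d by apply: growth_bounded.
  rewrite /D (transfer_unfold i' j (cg (vert i') d dB)).
  under eq_bigr => l _.
    rewrite (_ : edge_shift _ _ = (fun s => d [::] * edge_shift (step i' l) (a (vert i')) s +
        convolution a (vert l) (edge_shift (step i' l) d) s)); last first.
      apply/funext => s; rewrite /edge_shift; case E : (step i' l) => [e|].
        by have [_ <-] := Mv E; rewrite /= mulrC.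
      by rewrite mulr0 add0r convolution0.
    rewrite (transfer_linear l j _ (growth_edge_shift _ (ag _)) (cg _ _ (edge_shift_bounded _ dB))).
    rewrite mulrDr (mulrCA _ (d [::])).
    over.
  rewrite big_split /= -mulr_sumr.
  rewrite [in RHS](eq_bigr _ (fun l _ => mulrBr _ _ _)) sumrB.
  have -> : \sum_l transfer i' l d * transfer l j (a (vert l)) =
     d [::] * transfer i' j (a (vert i')) + \sum_m (weight i' m)%:C%C *
       \sum_l transfer m l (edge_shift (step i' m) d) * transfer l j (a (vert l)).
    under eq_bigr => l _ do rewrite (transfer_unfold i' l dg) mulrDl mulr_suml.
    rewrite big_split /= exchange_big /=; congr (_ + _).
      rewrite (bigD1 i')//= eqxx mul1r big1 ?addr0// => l /negbTE li.
      by rewrite eq_sym li !mul0r.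
    by apply: eq_bigr => m _; rewrite mulr_sumr; apply: eq_bigr => l _; rewrite mulrA.
  by rewrite addr0 (transfer_unfold i' j (ag (vert i'))); ring.
(* K bounds D uniformly over the families bounded by B. *)
pose K := 4 * (A * B) + \sum_(l : state M) (4 * B) * (4 * A).
have D0 n i' (d : word -> C) : (forall s, normc (d s) <= B) ->
    normc (D i' d) <= K / 2 ^+ n.
  elim: n i' d => [|n IH] i' d dB.
    rewrite expr0 divr1 /D; apply: le_trans (normcD _ _) _; rewrite normcN lerD//.
      by apply: transfer_bound; exact: cg.
    apply: le_trans (normc_sum _ _) _; apply: ler_sum => l _; rewrite normcM.
    rewrite ler_pM ?normc_ge0//; last exact: transfer_bound.
    by apply: transfer_bound; apply: growth_bounded.
  rewrite D_unfold//; apply: le_trans (contraction_sum i' (c := K / 2 ^+ n) Mc _) _.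
    by move=> l; apply: IH; exact: edge_shift_bounded.
  have K0 : 0 <= K / 2 ^+ n by apply: le_trans (IH i' d dB); exact: normc_ge0.
  have -> : K / 2 ^+ n.+1 = K / 2 ^+ n / 2 by rewrite exprS; field; rewrite expf_neq0.
  lra.
apply/eqP; rewrite -subr_eq0; apply/eqP/eq0_normc.
by apply: (@geometric_eq0 _ _ K) => [|n]; [exact: normc_ge0|exact: D0].
Qed.

Definition word_delta (w s : word) : C := (s == w)%:R.

Fixpoint trace i (w : word) k : bool :=
  if w is e :: w' then [exists l, (step i l == Some e) && trace l w' k] else i == k.

Lemma trace_cons i e w k :
  trace i (e :: w) k = [exists l, (step i l == Some e) && trace l w k].
Proof. by []. Qed.

Lemma growth_word_delta w : growth 1 (word_delta w).
Proof.
by apply: growth_bounded => s; rewrite /word_delta; case: eqP => _; rewrite ?normc1 ?normc0.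
Qed.

Lemma transfer_word_cons i k e w :
  transfer i k (word_delta (e :: w)) =
  \sum_(l | step i l == Some e) (weight i l)%:C%C * transfer l k (word_delta w).
Proof.
rewrite (transfer_unfold i k (growth_word_delta _)) {1}/word_delta /= mulr0 add0r.
rewrite [RHS]big_mkcond; apply: eq_bigr => l _.
case: eqP => [->|ne].
  congr (_ * transfer _ _ _); apply/funext => s.
  by rewrite /edge_shift /word_delta eqseq_cons eqxx.
rewrite transfer0 ?mulr0// => s; rewrite /edge_shift; case E : (step i l) => [f|//].
rewrite /word_delta eqseq_cons; case: eqP => //= fe.
by case: ne; rewrite E fe.
Qed.

Hypothesis Mp : weight_positive M.

(** Positivity rules out cancellation between the runs reading w. *)
Lemma transfer_word i w k :
  0 <= transfer i k (word_delta w) /\ (transfer i k (word_delta w) != 0) = trace i w k.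
Proof.
elim: w i => [|e w IH] i.
  rewrite (transfer_unfold i k (growth_word_delta _)) big1 => [|l _].
    rewrite addr0 /word_delta eqxx mulr1 ler0n; split=> //.
    by rewrite pnatr_eq0 eqb0 negbK.
  rewrite transfer0 ?mulr0// => s; rewrite /edge_shift.
  by case: (step i l).
rewrite transfer_word_cons.
have h l : 0 <= (weight i l)%:C%C * transfer l k (word_delta w).
  by rewrite mulr_ge0 ?(IH l).1// lecR; case: (Mc i).
split; first by apply: sumr_ge0.
rewrite psumr_eq0// -has_predC.
have lw l : ((weight i l)%:C%C * transfer l k (word_delta w) != 0) =
    (weight i l != 0) && trace l w k.
  by rewrite mulf_eq0 negb_or (IH l).2 (inj_eq (@complexI R)).
apply/hasP/existsP => -[l].
  move=> _; rewrite /= negb_imply lw => /and3P[il _ lk].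
  by exists l; apply/andP.
move=> /andP[il lk]; exists l; first exact: mem_index_enum.
rewrite /= negb_imply lw; apply/and3P; split; [exact: il| |exact: lk].
by rewrite gt_eqF// Mp// (eqP il).
Qed.

End ContractiveAutomaton.

End Transfer.

(** * Operators and coordinate nests in finite dimension *)
Section LipschitzLinear.
Variables (R : realType) (V W : normedModType R[i]).

Lemma lipschitz_linear_continuous (f : V -> W) (k : R) :
  linear f -> 0 <= k -> (forall x, `|f x| <= k%:C%C * `|x|) -> continuous f.
Proof.
move=> fl k0 fk.
pose g : {linear V -> W} := HB.pack f (GRing.isLinear.Build _ _ _ _ f fl).
apply: (@bounded_linear_continuous _ _ _ g); apply/bounded_funP => r.
exists (k%:C%C * r) => x xr; apply: le_trans (fk x) _.
by rewrite ler_wpM2l// lecR.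
Qed.

End LipschitzLinear.

Section FiniteDimension.
Variables (R : realType) (J : finType).
Local Notation C := R[i].
Local Notation H := (ell2 R J).
Implicit Types (f g : H) (i j : J).

Lemma finvec_subproof (v : J -> C) : v \in square_summable (R := R) (I := J).
Proof.
apply/asboolP; apply: (@le_lt_trans _ _ (\sum_j normc (v j) ^+ 2)%:E); last exact: ltry.
apply: sqsum_le_fin => X; rewrite big_uniq ?fset_uniq//=.
by rewrite big_mkcond/=; apply: ler_sum => j _; case: ifP; rewrite // sqr_ge0.
Qed.

Definition finvec (v : J -> C) : H := Ell2 (finvec_subproof v).

Lemma ell2_sumE (I : choiceType) (A : Type) (s : seq A) (F : A -> ell2 R I) (i : I) :
  (\sum_(a <- s) F a) i = \sum_(a <- s) F a i.
Proof. by elim: s => [|a s IH]; rewrite ?big_nil// !big_cons -IH. Qed.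

Lemma finvec_decomposition f : f = \sum_j f j *: basis R j.
Proof.
apply/val_inj/funext => i /=; rewrite ell2_sumE (bigD1 i)//= big1 ?addr0 => [|j ji].
  by rewrite /= -[RHS]/(f i * (i == i)%:R) eqxx mulr1.
by rewrite -[LHS]/(f j * (i == j)%:R) eq_sym (negbTE ji) mulr0.
Qed.

Lemma ell2_norm_le_sum f : ell2_norm f <= \sum_j normc (f j).
Proof.
rewrite {1}[f]finvec_decomposition; elim/big_ind2: _ => [|x1 x2 y1 y2 h1 h2|j _].
- by rewrite /ell2_norm sqsum0 fine0 sqrtr0.
- by apply: le_trans (ell2_normD _ _) _; exact: lerD.
- by rewrite ell2_normZ ler_piMr ?normc_ge0// basis_norm.
Qed.

Definition matrix_fun (m : J -> J -> C) f : H := finvec (fun j => \sum_i m i j * f i).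

Lemma matrix_fun_bound (m : J -> J -> C) f :
  ell2_norm (matrix_fun m f) <= (\sum_j \sum_i normc (m i j)) * ell2_norm f.
Proof.
apply: le_trans (ell2_norm_le_sum _) _; rewrite mulr_suml; apply: ler_sum => j _.
apply: le_trans (normc_sum _ _) _; rewrite mulr_suml; apply: ler_sum => i _.
by rewrite normcM ler_wpM2l ?normc_ge0// ell2_coord_le.
Qed.

Lemma matrix_subproof (m : J -> J -> C) :
  matrix_fun m \in bounded_operator (R := R) (I := J).
Proof.
apply/asboolP; split=> [k f g|].
  apply/val_inj/funext => j /=.
  rewrite -[RHS]/(k * (\sum_i m i j * f i) + \sum_i m i j * g i).
  rewrite mulr_sumr -big_split /=; apply: eq_bigr => i _.
  by transitivity (m i j * (k * f i + g i)) => //; ring.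
exists (\sum_j \sum_i normc (m i j)) => f; exact: matrix_fun_bound.
Qed.

(** Indexed so that [m i j] is the coefficient from the i-th to the j-th basis
    vector. *)
Definition matrix_operator (m : J -> J -> C) : bop R J := Bop (matrix_subproof m).

Lemma matrix_operatorE m f j : matrix_operator m f j = \sum_i m i j * f i.
Proof. by []. Qed.

Lemma matrix_operator_basis m i j : matrix_operator m (basis R i) j = m i j.
Proof.
rewrite matrix_operatorE (bigD1 i)//= eqxx mulr1 big1 ?addr0// => l /negbTE li.
by rewrite li mulr0.
Qed.

Lemma operator_basis_eq (S T : bop R J) :
  (forall i j, S (basis R i) j = T (basis R i) j) -> S = T.
Proof.
move=> ST; apply/val_inj/funext => f /=.
rewrite [f]finvec_decomposition !linear_sum; apply: eq_bigr => i _.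
by rewrite !linearZ; congr (_ *: _); apply/val_inj/funext => j; exact: ST.
Qed.

Lemma matrix_operator_norm m : opnorm (matrix_operator m) <= \sum_j \sum_i normc (m i j).
Proof.
apply: opnorm_lub => f f1; apply: le_trans (matrix_fun_bound m f) _.
rewrite ler_piMr//; apply: sumr_ge0 => j _; apply: sumr_ge0 => i _; exact: normc_ge0.
Qed.

Variable reach : rel J.
Hypothesis reach_refl : reflexive reach.
Hypothesis reach_total : total reach.

Definition coordinate_subspace (D : J -> Prop) : set H :=
  [set f | forall i, ~ D i -> f i = 0]%classic.

Definition upset (D : J -> Prop) := forall i j, D i -> reach i j -> D j.

Definition upset_nest : set (set H) :=
  [set X | exists2 D, upset D & X = coordinate_subspace D]%classic.

Lemma coordinate_continuous i : continuous (fun f : H => f i : C^o).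
Proof.
apply: (@lipschitz_linear_continuous R H C^o _ 1) => // f.
have -> : `|(f i : C^o)| = (normc (f i))%:C%C :> C by [].
by rewrite mul1r ell2_normE lecR ell2_coord_le.
Qed.

Lemma coordinate_subspace_closed D : closed_subspace (coordinate_subspace D).
Proof.
split.
  rewrite (_ : coordinate_subspace D =
      \bigcap_(i in [set i | ~ D i]) (fun f : H => f i : C^o) @^-1` [set 0])%classic.
    apply: closed_bigI => i _; apply: closed_comp => [f _|]; first exact: coordinate_continuous.
    apply: accessible_closed_set1; apply: hausdorff_accessible; exact: norm_hausdorff.
  by apply/seteqP; split.
split=> [i //|k f g fD gD i Di].
by rewrite -[LHS]/(k * f i + g i) fD// gD// mulr0 addr0.
Qed.

Lemma basis_coordinate_subspace (D : J -> Prop) i : D i -> coordinate_subspace D (basis R i).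
Proof. by move=> Di j Dj /=; case: eqP => // ji; case: Dj; rewrite ji. Qed.

Lemma subspace_sum (I : choiceType) (M : set (ell2 R I)) (A : Type) (s : seq A) F :
  Defs.subspace M -> (forall a, M (F a)) -> M (\sum_(a <- s) F a).
Proof.
move=> [M0 ML] MF; elim: s => [|a s IH]; first by rewrite big_nil; exact: M0.
by rewrite big_cons -[F a]scale1r; exact: ML.
Qed.

(** Upsets are closed under intersections and unions and, when [reach] is total,
    form a chain; the corresponding subspaces are spanned by the basis vectors
    that they contain. *)
Lemma upset_nestP : nest upset_nest.
Proof.
split.
- by move=> _ [D _ ->]; exact: coordinate_subspace_closed.
- exists (fun=> False) => //; apply/seteqP; split=> [f /= -> //|f f0 /=].
  by apply/val_inj/funext => i; exact: f0.
- by exists (fun=> True) => //; apply/seteqP; split=> f //= _ i [].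
- move=> _ _ [D uD ->] [D' uD' ->].
  have [DD'|/existsNP[i /not_implyP[Di D'i]]] := pselect (forall i, D i -> D' i).
    by left=> f fD i D'i; apply: fD => /DD'.
  right=> f fD' j Dj; apply: fD' => D'j.
  by have /orP[ij|ji] := reach_total i j; [apply: Dj; exact: uD ij|apply: D'i; exact: uD' ji].
- move=> F FN; split.
    pose D i := forall D', upset D' -> F (coordinate_subspace D') -> D' i.
    exists D.
      by move=> i j Di ij D' uD' FD'; exact: (uD' i j (Di D' uD' FD') ij).
    apply/seteqP; split=> [f fF i /existsNP[D' /not_implyP[uD' /not_implyP[FD' D'i]]]|f fD X FX].
      exact: (fF _ FD').
    have [D' uD' XE] := FN _ FX; rewrite XE => i D'i; apply: fD => Di; apply: D'i.
    by apply: Di => //; rewrite -XE.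
  pose D i := exists D', [/\ upset D', F (coordinate_subspace D') & D' i].
  exists D.
    by move=> i j [D' [uD' FD' D'i]] ij; exists D'; split=> //; exact: uD' ij.
  apply/seteqP; split.
    apply: smallest_sub; first exact: coordinate_subspace_closed.
    move=> f [X FX Xf]; have [D' uD' XE] := FN _ FX.
    move: Xf; rewrite XE => fD' i Di; apply: fD' => D'i; apply: Di.
    by exists D'; split=> //; rewrite -XE.
  move=> f fD K [[_ sK] FK]; rewrite [f]finvec_decomposition; apply: subspace_sum => // i.
  have [K0 KL] := sK.
  have [[D' [uD' FD' D'i]]|Di] := pselect (D i).
    rewrite -[_ *: _]addr0; apply: KL => //; apply: FK.
    by exists (coordinate_subspace D') => //; exact: basis_coordinate_subspace.
  by rewrite fD// scale0r.
Qed.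

(** For the direct implication, invariance is tested on the principal upsets. *)
Lemma upset_nest_algebraP T : transitive reach ->
  nest_algebra upset_nest T <-> forall i j, ~~ reach i j -> T (basis R i) j = 0.
Proof.
move=> rt; split=> [TN i j ij|T0 _ [D uD ->] _ [f fD <-] j Dj].
  have := TN (coordinate_subspace (fun j => reach i j)) _ (T (basis R i)).
  apply; last exact/negP.
    by exists (fun j => reach i j) => // k l; exact: rt.
  by exists (basis R i) => //; exact: basis_coordinate_subspace.
rewrite [f]finvec_decomposition linear_sum ell2_sumE big1// => i _.
rewrite linearZ -[LHS]/(f i * T (basis R i) j).
have [ij|ij] := boolP (reach i j); last by rewrite T0 ?mulr0.
by rewrite fD ?mul0r// => Di; apply: Dj; exact: uD ij.
Qed.

End FiniteDimension.

(** * The representation of an automaton *)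
Section AutomatonRepresentation.
Variables (R : realType) (G : digraph).
Local Notation C := R[i].
Local Notation word := (seq (edge G)).
Local Notation L := (free_semigroupoid_algebra R G).
Local Notation gen := (generated_algebra (range (@creation R G))).

Definition arrow (M : automaton R G) : rel (state M) := fun i l => step i l != None.

(** The word must lead back to i and must not be readable from the other states
    over the same vertex; states over other vertices do not matter, because the
    creation operator of a path kills them. *)
Definition state_separating (M : automaton R G) := forall i : state M,
  exists2 w, walk (vert i) w &
    forall j k, vert j = vert i -> trace j w k = (j == i) && (k == i).

Section Coefficients.
Variable M : automaton R G.
Hypotheses (Mc : contractive M) (Mv : compatible M) (Mp : weight_positive M).
Implicit Types (i j k l : state M) (S T : bop R (gpath G)).

Definition coefficient T i j : C := transfer i j (fourier T (vert i)).

Lemma fourier_growth T x : growth (opnorm T) (fourier T x).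
Proof. by apply: growth_bounded => s; exact: fourier_bound. Qed.

Lemma coefficient_bound T i j : normc (coefficient T i j) <= 4 * opnorm T.
Proof. by apply: transfer_bound => //; exact: fourier_growth. Qed.

Lemma coefficient_linear (z : C) S T i j :
  coefficient (z *: S + T) i j = z * coefficient S i j + coefficient T i j.
Proof.
rewrite /coefficient -(transfer_linear Mc _ _ _ (fourier_growth S _) (fourier_growth T _)).
by congr transfer; apply/funext => s; exact: fourier_linear.
Qed.

Lemma coefficient0 i j : coefficient 0 i j = 0.
Proof. by apply: transfer0 => // s; rewrite /fourier /word_coord; case: insubP. Qed.

Lemma coefficient_comp S T i j : convolver S -> convolver T ->
  coefficient (bop_comp S T) i j = \sum_l coefficient T i l * coefficient S l j.
Proof.
move=> cS cT; rewrite -(transfer_convolution Mc Mv _ _ (fourier_bound S) (fourier_bound T _)).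
by congr transfer; apply/funext => s; exact: convolver_comp.
Qed.

Lemma partial0 n i j (a : word -> C) : (forall s, a s = 0) -> partial n i j a = 0.
Proof.
elim: n i a => [|n IH] i a a0 //=; rewrite a0 mulr0 add0r big1// => l _.
have -> : partial n l j (edge_shift (step i l) a) = 0; last by rewrite mulr0.
by apply: IH => s; case: (step i l) => [e|] /=.
Qed.

Lemma partial_unreachable n i j (a : word -> C) :
  ~~ connect (@arrow M) i j -> partial n i j a = 0.
Proof.
elim: n i a => [|n IH] i a ij //=.
have [e|_] := eqVneq i j; first by rewrite e connect0 in ij.
rewrite mul0r add0r big1// => l _; have [il|il] := eqVneq (step i l) None.
  by rewrite partial0 ?mulr0// => s; rewrite il.
rewrite IH ?mulr0//; apply: contra ij; apply: connect_trans; exact: connect1.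
Qed.

Lemma coefficient_unreachable T i j :
  ~~ connect (@arrow M) i j -> coefficient T i j = 0.
Proof.
move=> ij; apply: (transfer_lim Mc (fourier_growth T _)).
under eq_fun do rewrite partial_unreachable//; exact: geometric_lim_cst.
Qed.

Lemma coefficient_creation (p : gpath G) i j :
  coefficient (creation R p) i j =
  if vert i == psource p then transfer i j (word_delta R (pedges p)) else 0.
Proof.
rewrite /coefficient (_ : fourier _ _ = path_delta R (psource p) (pedges p) (vert i)); last first.
  by apply/funext => s; exact: fourier_creation.
rewrite /path_delta; case: eqP => [//|_]; by rewrite transfer0.
Qed.

Definition realizes_unit T i j :=
  gen T /\ forall i' j', coefficient T i' j' = ((i' == i) && (j' == j))%:R.

Lemma generated_subalgebra : subalgebra gen.
Proof.
split=> [A [[A0 _ _] _] //|z S T genS genT A [AA XA]|S T genS genT A [AA XA]].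
  by case: (AA) => _ AL _; apply: AL; [apply: genS|apply: genT].
by case: (AA) => _ _ Acomp; apply: Acomp; [apply: genS|apply: genT].
Qed.

Lemma generated_creation (p : gpath G) : gen (creation R p).
Proof. by move=> A [_ XA]; apply: XA; exists p. Qed.

Lemma generatedZ (z : C) T : gen T -> gen (z *: T).
Proof.
have [g0 gL _] := generated_subalgebra.
by move=> genT; rewrite -[_ *: _]addr0; apply: gL.
Qed.

Lemma generated_sum (A : Type) (s : seq A) (F : A -> bop R (gpath G)) :
  (forall a, gen (F a)) -> gen (\sum_(a <- s) F a).
Proof.
have [g0 gL _] := generated_subalgebra => gF.
elim: s => [|a s IH]; first by rewrite big_nil.
by rewrite big_cons -[F a]scale1r; exact: gL.
Qed.

Lemma coefficientZ (z : C) T i j : coefficient (z *: T) i j = z * coefficient T i j.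
Proof. by rewrite -[_ *: _]addr0 coefficient_linear coefficient0 addr0. Qed.

Lemma coefficient_sum (A : Type) (s : seq A) (F : A -> bop R (gpath G)) i j :
  coefficient (\sum_(a <- s) F a) i j = \sum_(a <- s) coefficient (F a) i j.
Proof.
elim: s => [|a s IH]; first by rewrite !big_nil coefficient0.
by rewrite !big_cons -[F a in LHS]scale1r coefficient_linear mul1r IH.
Qed.

Lemma realizes_comp T S i j k : realizes_unit T i j -> realizes_unit S j k ->
  realizes_unit (bop_comp S T) i k.
Proof.
have [_ _ gC] := generated_subalgebra => -[genT Tij] [genS Sjk]; split; first exact: gC.
move=> i' k'; rewrite coefficient_comp; [|exact: convolver_generated..].
rewrite (bigD1 j)//= big1 => [|l /negbTE lj].
  by rewrite Tij Sjk !eqxx andbT addr0 -natrM mulnb.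
by rewrite Tij lj andbF mul0r.
Qed.

Hypothesis Ms : state_separating M.

(** The creation operator of a separating word is mapped to a multiple of a
    diagonal matrix unit, nonzero since the run from i has positive weight. *)
Lemma realizes_diagonal i : exists T, realizes_unit T i i.
Proof.
have [w ww sep] := Ms i; pose p := @GPath G (vert i, w) ww.
pose c := transfer i i (word_delta R w).
have c0 : c != 0 by rewrite (transfer_word Mc Mp i w i).2 sep// eqxx.
exists (c^-1 *: creation R p); split=> [|i' j'].
  by apply: generatedZ; exact: generated_creation.
rewrite coefficientZ coefficient_creation /psource /pedges /=.
case: (eqVneq (vert i') (vert i)) => [vi|vi]; last first.
  by case: eqP => [ii|_] /=; rewrite ?mulr0//; rewrite ii eqxx in vi.
have [/andP[/eqP-> /eqP->]|nij] := boolP ((i' == i) && (j' == i)).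
  by rewrite mulVf.
have := (transfer_word Mc Mp i' w j').2; rewrite sep// (negbTE nij) => /negbFE/eqP ->.
by rewrite mulr0.
Qed.

(** Diagonal matrix units on both sides isolate, in the image of the creation
    operator of an edge, the entry of a single transition. *)
Lemma realizes_step i j : arrow i j -> exists T, realizes_unit T i j.
Proof.
rewrite /arrow; case E : (step i j) => [e|//] _.
have [Ti [gi ri]] := realizes_diagonal i; have [Tj [gj rj]] := realizes_diagonal j.
have we : walk (vert i) [:: e] by rewrite /= (Mv E).1 eqxx.
pose p := @GPath G (vert i, [:: e]) we.
pose c := transfer i j (word_delta R [:: e]).
have c0 : c != 0.
  rewrite (transfer_word Mc Mp i [:: e] j).2 /=; apply/existsP; exists j.
  by rewrite E !eqxx.
have [_ _ gC] := generated_subalgebra.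
have gp := generated_creation p.
exists (c^-1 *: bop_comp Tj (bop_comp (creation R p) Ti)); split=> [|i' j'].
  by apply: generatedZ; apply: (gC) => //; exact: gC.
have gpi := gC _ _ gp gi.
rewrite coefficientZ coefficient_comp; [|exact: convolver_generated..].
have -> : \sum_l coefficient (bop_comp (creation R p) Ti) i' l * coefficient Tj l j' =
    (i' == i)%:R * c * (j' == j)%:R.
  rewrite (bigD1 j)//= big1 => [|l /negbTE lj]; last by rewrite rj lj mulr0.
  rewrite addr0 rj eqxx /=; congr (_ * _).
  rewrite coefficient_comp; [|exact: convolver_generated..].
  rewrite (bigD1 i)//= big1 => [|l /negbTE li]; last by rewrite ri li andbF mul0r.
  by rewrite addr0 ri eqxx andbT; congr (_ * _); rewrite coefficient_creation eqxx.
by case: (i' == i); case: (j' == j); rewrite /= ?mul0r ?mulr0 ?mul1r ?mulr1 ?mulr0 ?mulVf.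
Qed.

Lemma realizes_connect i j : connect (@arrow M) i j -> exists T, realizes_unit T i j.
Proof.
move=> /connectP[p]; elim: p i => [|l p IH] i /=.
  by move=> _ ->; exact: realizes_diagonal.
move=> /andP[il pl] jE; have [T Til] := realizes_step il.
by have [S Slj] := IH l pl jE; exists (bop_comp S T); exact: realizes_comp Slj.
Qed.

Lemma realizes_matrix (m : state M -> state M -> C) :
    (forall i j, ~~ connect (@arrow M) i j -> m i j = 0) ->
  exists2 T, gen T & forall i j, coefficient T i j = m i j.
Proof.
move=> m0.
have /choice[F FP] (ij : state M * state M) : exists T, gen T /\ forall i j,
    coefficient T i j = m ij.1 ij.2 * ((i == ij.1) && (j == ij.2))%:R.
  case: ij => k l /=.
  have [kl|kl] := boolP (connect (@arrow M) k l).
    have [T [genT Tkl]] := realizes_connect kl; exists (m k l *: T).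
    by split=> [|i j]; [exact: generatedZ|rewrite coefficientZ Tkl].
  exists 0; split=> [|i j]; first by case: generated_subalgebra.
  by rewrite m0// mul0r coefficient0.
exists (\sum_ij F ij); first by apply: generated_sum => ij; case: (FP ij).
move=> i j; rewrite coefficient_sum (bigD1 (i, j))//= (FP (i, j)).2 /= !eqxx mulr1.
rewrite big1 ?addr0// => -[k l] /=; rewrite xpair_eqE => /negbTE kl.
by rewrite (FP (k, l)).2 /= (eq_sym i) (eq_sym j) kl mulr0.
Qed.

Local Notation J := 'I_#|state M|.

Definition automaton_rep T : bop R J :=
  matrix_operator (fun i j : J => coefficient T (enum_val i) (enum_val j)).

Lemma automaton_rep_representation : representation L automaton_rep.
Proof.
have repL (z : C) S T : automaton_rep (z *: S + T) = z *: automaton_rep S + automaton_rep T.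
  apply: operator_basis_eq => i j.
  rewrite -[RHS]/(z * automaton_rep S (basis R i) j + automaton_rep T (basis R i) j).
  by rewrite !matrix_operator_basis coefficient_linear.
split=> [|z S T _ _|S T
  /free_semigroupoid_algebra_convolver cS /free_semigroupoid_algebra_convolver cT].
- apply: continuous_subspaceT.
  apply: (@lipschitz_linear_continuous _ _ _ _ (\sum_(j : J) \sum_(i : J) 4)).
  + by move=> z S T; exact: repL.
  + by apply: sumr_ge0 => j _; apply: sumr_ge0.
  + move=> T; rewrite !opnormE -rmorphM lecR.
    apply: le_trans (matrix_operator_norm _) _.
    rewrite mulr_suml; apply: ler_sum => j _; rewrite mulr_suml; apply: ler_sum => i _.
    exact: coefficient_bound.
- exact: repL.
- apply: operator_basis_eq => i j.
  rewrite matrix_operator_basis coefficient_comp//.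
  rewrite -[RHS]/(automaton_rep S (automaton_rep T (basis R i)) j) matrix_operatorE.
  rewrite [LHS](reindex (@enum_val _ (state M))) /=; last first.
    by apply: onW_bij; exact: enum_val_bij.
  apply: eq_bigr => l _; rewrite mulrC; congr (_ * _).
  exact: (esym (matrix_operator_basis (fun i j : J => coefficient T (enum_val i) (enum_val j)) i l)).
Qed.

Hypothesis Mt : total (connect (@arrow M)).

(** Density holds because the image is the whole nest algebra, which consists of
    the matrices supported on the pairs (i, j) with j reachable from i. *)
Lemma automaton_rep_nest_representation : nest_representation L automaton_rep.
Proof.
split; first exact: automaton_rep_representation.
pose reach : rel J := fun i j : J => connect (@arrow M) (enum_val i) (enum_val j).
have rt : transitive reach by move=> y x z; exact: connect_trans.
have rr : reflexive reach by move=> x; exact: connect0.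
exists (@upset_nest R J reach).
  by apply: upset_nestP => // x y; exact: Mt.
split=> [_ [T LT <-]|T].
  apply/upset_nest_algebraP => // i j ij.
  by rewrite matrix_operator_basis coefficient_unreachable.
move=> /upset_nest_algebraP => /(_ rr rt) T0.
have [|S genS SE] := @realizes_matrix (fun i j : state M => T (basis R (enum_rank i)) (enum_rank j)).
  by move=> i j ij; apply: T0; rewrite /reach !enum_rankK.
apply: (@subset_closure (initial_topology (@coefficients R J))).
exists S; first exact: generated_sub_free_semigroupoid_algebra.
by apply: operator_basis_eq => i j; rewrite matrix_operator_basis SE !enum_valK.
Qed.

Lemma automaton_rep_neq0 T i j : coefficient T i j <> 0 -> automaton_rep T <> 0.
Proof.
move=> Tij T0; apply: Tij.
have := matrix_operator_basis (fun k l : J => coefficient T (enum_val k) (enum_val l))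
  (enum_rank i) (enum_rank j).
by rewrite !enum_rankK => <-; rewrite -[matrix_operator _]/(automaton_rep T) T0.
Qed.

End Coefficients.
End AutomatonRepresentation.

(** * Joining two automata by an edge *)
Section Gluing.
Variables (R : realType) (G : digraph).
Local Notation C := R[i].
Local Notation word := (seq (edge G)).

Definition endpoint (x : vertex G) (w : word) := last x (map (@range_of G) w).

Definition reachable (x y : vertex G) := exists2 w, walk x w & endpoint x w = y.

Lemma endpoint_cat x v w : endpoint x (v ++ w) = endpoint (endpoint x v) w.
Proof. by rewrite /endpoint map_cat last_cat. Qed.

Lemma reachable_refl x : reachable x x. Proof. by exists [::]. Qed.

Lemma reachable_trans y x z : reachable x y -> reachable y z -> reachable x z.
Proof.
move=> [v xv <-] [w yw <-]; exists (v ++ w); last exact: endpoint_cat.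
by rewrite walk_cat xv.
Qed.

Lemma connect_reachable (M : automaton R G) (i j : state M) : compatible M ->
  connect (@arrow R G M) i j -> reachable (vert i) (vert j).
Proof.
move=> Mv /connectP[p]; elim: p i => [|l p IH] i /=; first by move=> _ ->; exact: reachable_refl.
rewrite {1}/arrow; case E : (step i l) => [e|//] /= pl jE.
apply: (@reachable_trans (vert l)); last exact: IH.
by have [se re] := Mv _ _ _ E; exists [:: e]; rewrite //= se eqxx.
Qed.

Lemma trace_endpoint (M : automaton R G) (i k : state M) w : compatible M ->
  trace i w k -> vert k = endpoint (vert i) w.
Proof.
move=> Mv; elim: w i => [|e w IH] i /=; first by move/eqP->.
move=> /existsP[l /andP[/eqP il lk]].
by rewrite (IH _ lk) /endpoint /= (Mv _ _ _ il).2.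
Qed.

Definition strongly_connected (M : automaton R G) :=
  forall i j : state M, connect (@arrow R G M) i j.

Variables (M1 M2 : automaton R G) (q : state M1) (q' : state M2) (e : edge G).

Definition graft : automaton R G := {|
  state := (state M1 + state M2)%type;
  vert u := match u with inl i => vert i | inr j => vert j end;
  step u v := match u, v with
    | inl i, inl j => step i j
    | inr i, inr j => step i j
    | inl i, inr j => if (i == q) && (j == q') then Some e else None
    | inr _, inl _ => None
    end;
  weight u v := match u, v with
    | inl i, inl j => weight i j
    | inr i, inr j => weight i j
    | inl i, inr j => if (i == q) && (j == q') then 8^-1 else 0
    | inr _, inl _ => 0
    end |}.

Definition graft_left (i : state M1) : state graft := inl i.
Definition graft_right (i : state M2) : state graft := inr i.

Lemma sum_graft (A : nmodType) (F : state graft -> A) :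
  \sum_u F u = \sum_i F (graft_left i) + \sum_j F (graft_right j).
Proof. exact: big_sumType. Qed.

(** Half of the contraction bound, which leaves room for one more transition of
    weight 1/8 at each state. *)
Definition tight (M : automaton R G) := forall i : state M,
  (forall l, 0 <= weight i l) /\ \sum_(l : state M) weight i l <= 8^-1.

Lemma tight_contractive (M : automaton R G) : tight M -> contractive M.
Proof. by move=> Mt i; have [w0 w8] := Mt i; split=> //; lra. Qed.

Hypotheses (M1t : tight M1) (M1v : compatible M1) (M1p : weight_positive M1)
  (M1s : state_separating M1) (M1c : strongly_connected M1).
Hypotheses (M2c : contractive M2) (M2v : compatible M2) (M2p : weight_positive M2)
  (M2s : state_separating M2) (M2t : total (connect (@arrow R G M2)))
  (M2q : forall j, connect (@arrow R G M2) q' j).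
Hypotheses (se : source_of e = vert q) (re : range_of e = vert q').
Hypothesis disj : forall (i : state M1) (j : state M2), vert i <> vert j.

Lemma graft_contractive : contractive graft.
Proof.
move=> [i|i].
  have [w0 w8] := M1t i; split=> [[j|j]|]; first exact: w0.
    by rewrite /=; case: ifP.
  rewrite sum_graft /=.
  have : \sum_j (if (i == q) && (j == q') then 8^-1 else 0) <= 8^-1 :> R.
    have [_|_] /= := eqVneq i q; last by rewrite big1.
    by rewrite -big_mkcond /= big_pred1_eq.
  lra.
have [w0 w4] := M2c i; split=> [[j|j]|]; [by []|exact: w0|].
by rewrite sum_graft /= big1// add0r.
Qed.

Lemma graft_compatible : compatible graft.
Proof.
move=> [i|i] [j|j] f //=; [exact: M1v| |exact: M2v].
by case: ifP => // /andP[/eqP-> /eqP->] [<-].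
Qed.

Lemma graft_weight_positive : weight_positive graft.
Proof.
move=> [i|i] [j|j] //=; [exact: M1p| |exact: M2p].
by case: ifP => // _ _; rewrite invr_gt0.
Qed.

Lemma trace_right_right i w k : trace (graft_right i) w (graft_right k) = trace i w k.
Proof.
elim: w i => [|f w IH] i /=; first exact: (inj_eq (@inr_inj _ _)).
apply/existsP/existsP => -[].
  by move=> [l|l] /andP[//= il lk]; exists l; rewrite il -IH.
by move=> l /andP[il lk]; exists (graft_right l); rewrite /= il IH.
Qed.

Lemma trace_right_left i w k : trace (graft_right i) w (graft_left k) = false.
Proof.
elim: w i => [|f w IH] i //=; apply/existsP => -[[l|l]] /andP[//= _].
by rewrite IH.
Qed.

Lemma trace_left_left i w k : trace (graft_left i) w (graft_left k) = trace i w k.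
Proof.
elim: w i => [|f w IH] i /=; first exact: (inj_eq (@inl_inj _ _)).
apply/existsP/existsP => -[].
  move=> [l|l] /andP[/= il lk]; first by exists l; rewrite il -IH.
  by move: lk; rewrite trace_right_left.
by move=> l /andP[il lk]; exists (graft_left l); rewrite /= il IH.
Qed.

(** A separating word of the first automaton, read from one of its states, cannot
    end in the second one: it would end over the vertex where it started, and
    no vertex lies below both. *)
Lemma graft_separating : state_separating graft.
Proof.
move=> [i|i].
  have [w iw sep] := M1s i; exists w => // -[j|j] k /= vj; last by case: (disj (esym vj)).
  case: k => k; first by rewrite [LHS]trace_left_left sep.
  rewrite andbF; apply/negP => /(trace_endpoint graft_compatible) /= vk.
  have : trace i w i by rewrite sep// eqxx.
  move=> /(trace_endpoint M1v) vi; apply: (@disj i k).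
  by rewrite vk vj.
have [w iw sep] := M2s i; exists w => // -[j|j] k /= vj; first by case: (disj vj).
case: k => k; last by rewrite [LHS]trace_right_right sep.
by rewrite andbF [LHS]trace_right_left.
Qed.

Lemma connect_map (M M' : automaton R G) (f : state M -> state M') i j :
    (forall i j, arrow i j -> arrow (f i) (f j)) ->
  connect (@arrow R G M) i j -> connect (@arrow R G M') (f i) (f j).
Proof.
move=> fa /connectP[p]; elim: p i => [|l p IH] i /=; first by move=> _ ->.
move=> /andP[il pl] jE; apply: connect_trans (IH _ pl jE).
by apply: connect1; exact: fa.
Qed.

Lemma graft_connect_left_right i j : connect (@arrow R G graft) (graft_left i) (graft_right j).
Proof.
apply: (@connect_trans _ _ (graft_left q)); first by apply: connect_map (M1c i q).
apply: (@connect_trans _ _ (graft_right q')); last by apply: connect_map (M2q j).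
by apply: connect1; rewrite /arrow /= !eqxx.
Qed.

Lemma graft_connect_left i u : connect (@arrow R G graft) (graft_left i) u.
Proof.
case: u => j; last exact: graft_connect_left_right.
by apply: (@connect_map _ _ graft_left) (M1c i j).
Qed.

Lemma graft_total : total (connect (@arrow R G graft)).
Proof.
move=> [i|i] u; first by rewrite graft_connect_left.
case: u => j; first by rewrite graft_connect_left orbT.
by have /orP[ij|ij] := M2t i j; apply/orP; [left|right]; apply: (@connect_map _ _ graft_right) ij.
Qed.

Lemma partial_right n i j (a : word -> C) : partial n (graft_right i) (graft_right j) a = partial n i j a.
Proof.
elim: n i a => [//|n IH] i a; rewrite !partialS sum_graft big1 ?add0r => [|l _].
  by rewrite (inj_eq (@inr_inj _ _)); congr (_ + _); apply: eq_bigr => l _; rewrite IH.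
by rewrite /= mul0r.
Qed.

Lemma transfer_right i j (a : word -> C) : transfer (graft_right i) (graft_right j) a = transfer i j a.
Proof.
rewrite /transfer (_ : (fun n => _) = (fun n => partial n i j a))//.
by apply/funext => n; exact: partial_right.
Qed.

Lemma transfer_graft c i j (a : word -> C) : growth c a ->
  transfer (graft_left i) (graft_right j) a =
  (i == q)%:R * ((8^-1 : R)%:C%C * transfer q' j (edge_shift (Some e) a)) +
  \sum_l (weight i l)%:C%C * transfer (graft_left l) (graft_right j) (edge_shift (step i l) a).
Proof.
move=> ac; rewrite (transfer_unfold graft_contractive _ _ ac) mul0r add0r sum_graft addrC.
congr (_ + _); rewrite (bigD1 q')//= eqxx andbT big1 => [|l /negbTE lq].
  rewrite addr0 transfer_right; case: (i == q) => /=; rewrite ?mul1r ?mul0r//.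
by rewrite lq andbF mul0r.
Qed.

End Gluing.

(** * The automaton of a periodic walk *)
Section CycleAutomaton.
Variables (R : realType) (G : digraph).
Local Notation C := R[i].
Local Notation word := (seq (edge G)).
Variables (g : nat -> edge G) (d : nat) (t : R).

Definition cycle_automaton : automaton R G := {|
  state := 'I_d;
  vert i := source_of (g i);
  step i l := if l == ordS i then Some (g i) else None;
  weight i l := if l == ordS i then t else 0 |}.

Hypothesis d_gt0 : (0 < d)%N.
Hypotheses (t_gt0 : 0 < t) (t_le : t <= 8^-1).
Hypothesis g_chain : forall k, range_of (g k) = source_of (g k.+1).
Hypothesis g_period : forall k, g (k + d) = g k.
Hypothesis g_minimal : forall m, (0 < m < d)%N -> exists k, g (k + m) <> g k.

(** Indexing the states by all natural numbers modulo d avoids the case of the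
    last transition, which closes the cycle. *)
Definition cycle_state k : state cycle_automaton := Ordinal (ltn_pmod k d_gt0).

Lemma cycle_stateS k : ordS (cycle_state k) = cycle_state k.+1.
Proof. by apply: val_inj; rewrite /= -addn1 modnDml addn1. Qed.

Lemma cycle_state_id (i : state cycle_automaton) : cycle_state i = i.
Proof. by apply: val_inj; rewrite /= modn_small. Qed.

Lemma cycle_state_period k : cycle_state (k + d) = cycle_state k.
Proof. by apply: val_inj; rewrite /= modnDr. Qed.

Lemma periodic_addM k n : g (k + n * d) = g k.
Proof. by elim: n => [|n IH]; rewrite ?addn0// mulSn addnCA addnC g_period. Qed.

Lemma periodic_mod k : g (k %% d) = g k.
Proof. by rewrite [in RHS](divn_eq k d) addnC periodic_addM. Qed.

Lemma cycle_sum (i : state cycle_automaton) (F : state cycle_automaton -> C) :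
  \sum_l (weight i l)%:C%C * F l = t%:C%C * F (ordS i).
Proof.
rewrite (bigD1 (ordS i))//= eqxx big1 ?addr0// => l /negbTE ->.
by rewrite mul0r.
Qed.

Lemma cycle_tight : tight cycle_automaton.
Proof.
move=> i; split=> [l|] /=; first by case: ifP => // _; exact: ltW.
by rewrite -big_mkcond /= big_pred1_eq.
Qed.

Lemma cycle_compatible : compatible cycle_automaton.
Proof.
move=> i l f /=; case: eqP => [->|//] [<-]; split=> //=.
by rewrite g_chain periodic_mod.
Qed.

Lemma cycle_weight_positive : weight_positive cycle_automaton.
Proof. by move=> i l /=; case: eqP. Qed.

Lemma cycle_strongly_connected : strongly_connected cycle_automaton.
Proof.
have H k n : connect (@arrow R G cycle_automaton) (cycle_state k) (cycle_state (k + n)).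
  elim: n => [|n IH]; first by rewrite addn0 connect0.
  apply: connect_trans IH _; apply: connect1.
  by rewrite addnS /arrow /= cycle_stateS eqxx.
move=> i j; rewrite -(cycle_state_id i) -(cycle_state_id j) -(cycle_state_period j).
have -> : (j + d)%N = (i + (j + d - i))%N.
  by rewrite subnKC// (leq_trans (ltnW (ltn_ord i)))// leq_addl.
exact: H.
Qed.

Lemma trace_cycle k w u : trace (cycle_state k) w u =
  (w == map g (iota k (size w))) && (u == cycle_state (k + size w)).
Proof.
elim: w k => [|e w IH] k; first by rewrite /= addn0 eq_sym.
transitivity ((g k == e) && trace (cycle_state k.+1) w u).
  rewrite trace_cons; apply/existsP/andP => [[l /andP[]]|[/eqP ge tr]].
    rewrite /=; case: (l =P ordS (cycle_state k)) => [->|_ //]; rewrite cycle_stateS => /eqP[] <-.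
    by rewrite periodic_mod eqxx.
  exists (cycle_state k.+1); rewrite tr andbT /= cycle_stateS eqxx.
  by rewrite periodic_mod ge.
by rewrite IH /= eqseq_cons addSnnS andbA eq_sym.
Qed.

Lemma walk_cycle k n : walk (source_of (g k)) (map g (iota k n)).
Proof. by elim: n k => //= n IH k; rewrite eqxx g_chain IH. Qed.

(** Two equal rotations would make j - i a smaller period. *)
Lemma rotation_inj i j : (i < j < d)%N ->
  map g (iota i d) <> map g (iota j d).
Proof.
move=> /andP[ij jd] E.
have [|k] := @g_minimal (j - i); first by rewrite subn_gt0 ij (leq_ltn_trans (leq_subr _ _) jd).
apply; pose m := ((k + (d - i)) %% d)%N.
have md : (m < d)%N by rewrite ltn_mod.
have im : ((i + m) %% d = k %% d)%N.
  rewrite modnDmr addnCA subnKC; last exact: ltnW (ltn_trans ij jd).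
  by rewrite modnDr.
have Em : g (i + m) = g (j + m).
  have := congr1 (fun s => nth (g 0) s m) E.
  by rewrite !(nth_map 0%N) ?size_iota// !nth_iota.
rewrite -[RHS]periodic_mod -im periodic_mod Em -[LHS]periodic_mod -modnDml -im modnDml periodic_mod.
by congr g; rewrite addnAC subnKC// ltnW.
Qed.

Lemma cycle_separating : state_separating cycle_automaton.
Proof.
move=> i; exists (map g (iota i d)); first exact: walk_cycle.
move=> j k _; rewrite -[j in LHS]cycle_state_id trace_cycle size_map size_iota
  cycle_state_period cycle_state_id.
have [->|ji] := eqVneq j i; first by rewrite eqxx.
apply/andP => -[/eqP E _].
have : (i < j)%N || (j < i)%N by rewrite -neq_ltn eq_sym.
by case/orP => h; [apply: (@rotation_inj i j)|apply: (@rotation_inj j i)];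
  rewrite ?h ?ltn_ord.
Qed.

End CycleAutomaton.

(** The degenerate cycle, for the empty closed walk at a vertex. *)
Section SingleVertex.
Variables (R : realType) (G : digraph) (x : vertex G).

Definition vertex_automaton : automaton R G := {|
  state := unit; vert _ := x; step _ _ := None; weight _ _ := 0 |}.

Lemma vertex_tight : tight vertex_automaton.
Proof. by move=> i; split=> //; rewrite big1// invr_ge0. Qed.

Lemma vertex_compatible : compatible vertex_automaton. Proof. by []. Qed.

Lemma vertex_weight_positive : weight_positive vertex_automaton. Proof. by []. Qed.

Lemma vertex_separating : state_separating vertex_automaton.
Proof. by move=> []; exists [::] => // -[] []. Qed.

Lemma vertex_strongly_connected : strongly_connected vertex_automaton.
Proof. by move=> [] []; exact: connect0. Qed.

End SingleVertex.

(** * Nonvanishing of a transfer *)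
Section Nonvanishing.
Variables (R : realType) (G : digraph).
Local Notation C := R[i].
Local Notation word := (seq (edge G)).

Definition prefix_shift (u : word) (a : word -> C) : word -> C := fun s => a (u ++ s).

Lemma growth_prefix_shift u c (a : word -> C) :
  growth c a -> growth (2 ^+ size u * c) (prefix_shift u a).
Proof.
move=> ac s; apply: le_trans (ac _) _.
by rewrite size_cat exprD mulrCA mulrA.
Qed.

(** The unfolding of the sums over runs that leave the block M from the state q,
    [Phi] being the sum over what follows.  The two uses are runs ending at q and
    runs continuing in a grafted automaton. *)
Definition exits_at (M : automaton R G) (q : state M) (Phi : (word -> C) -> C)
    (H : state M -> (word -> C) -> C) :=
  (forall i a c, growth c a -> H i a = (i == q)%:R * Phi a +
     \sum_l (weight i l)%:C%C * H l (edge_shift (step i l) a)) /\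
  (forall i a c, growth c a -> normc (H i a) <= 4 * c).

Section CycleExpansion.
Variables (g : nat -> edge G) (d : nat) (t : R) (d_gt0 : (0 < d)%N).
Hypothesis g_period : forall k, g (k + d) = g k.
Variables (b : nat) (Phi : (word -> C) -> C).
Variable H : 'I_d -> (word -> C) -> C.
Hypothesis HP : @exits_at (cycle_automaton g d t) (cycle_state g t d_gt0 b) Phi H.
Local Notation cycle_state := (cycle_state g t d_gt0).

(** The terms are the runs leaving the cycle after k transitions, for k < n; the
    last summand collects the runs that stay longer. *)
Lemma cycle_expansion c (a : word -> C) n : growth c a ->
  H (cycle_state 0) a =
  \sum_(k < n) t%:C%C ^+ k * ((cycle_state k == cycle_state b)%:R * Phi (prefix_shift (mkseq g k) a)) +
  t%:C%C ^+ n * H (cycle_state n) (prefix_shift (mkseq g n) a).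
Proof.
move=> ac; elim: n => [|n IH]; first by rewrite big_ord0 add0r expr0 mul1r.
rewrite IH big_ord_recr /= -addrA; congr (_ + _).
have := HP.1 (cycle_state n) _ _ (growth_prefix_shift (mkseq g n) ac).
move=> ->; rewrite mulrDr; congr (_ + _).
rewrite cycle_sum cycle_stateS exprSr mulrA; congr (_ * H _ _).
apply/funext => s.
by rewrite mkseqS /prefix_shift cat_rcons /= cycle_stateS eqxx (periodic_mod g_period).
Qed.

End CycleExpansion.

(** Let k be the least number of transitions after which the runs leaving the
    cycle contribute, and p the absolute value of [Phi] there.  Then [H] is t^k
    times the sum of a number of modulus p and of an error of modulus at most
    t * B, with B independent of t, so that any t < p / B is suitable. *)
Lemma cycle_nonvanishing (g : nat -> edge G) (d : nat) (d_gt0 : (0 < d)%N) b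
    (Phi : (word -> C) -> C) c (a : word -> C) :
    (forall k, g (k + d) = g k) -> growth c a ->
    Phi (prefix_shift (mkseq g b) a) != 0 ->
  exists t : R, [/\ 0 < t, t <= 8^-1 & forall H,
    @exits_at (cycle_automaton g d t) (cycle_state g t d_gt0 b) Phi H ->
    H (cycle_state g t d_gt0 0) a != 0].
Proof.
move=> gp ac Phib.
(* A run can leave the cycle after k transitions only if k = b modulo d. *)
pose hit k := (k == b %[mod d]) && (Phi (prefix_shift (mkseq g k) a) != 0).
have [k /andP[kb Phik] kmin] := ex_minnP (ex_intro hit b (introT andP (conj (eqxx _) Phib))).
set p := normc (Phi (prefix_shift (mkseq g k) a)).
have p_gt0 : 0 < p.
  rewrite lt_neqAle normc_ge0 andbT eq_sym; apply: contra Phik.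
  by move=> /eqP/eq0_normc ->.
pose B := 4 * (2 ^+ k.+1 * c).
have B0 : 0 <= B by rewrite !mulr_ge0 ?exprn_ge0// (growth_ge0 ac).
have pB : 0 < p / (2 * (B + 1)) by rewrite divr_gt0// mulr_gt0// ltr_wpDl.
exists (Num.min 8^-1 (p / (2 * (B + 1)))); set t := Num.min _ _.
have t_gt0 : 0 < t by rewrite lt_min invr_gt0 pB ltr0n.
split=> // [|H HP]; first by rewrite ge_min lexx.
apply/eqP => H0.
have := cycle_expansion gp HP k.+1 ac; rewrite H0 big_ord_recr /= big1 ?add0r; last first.
  move=> m _; have := kmin m; rewrite /hit
    -[m == b %[mod d]]/(cycle_state g t d_gt0 m == cycle_state g t d_gt0 b).
  case: eqP => _ /=; last by rewrite mul0r mulr0.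
  case: eqP => [->|_] => [_|/(_ isT)]; first by rewrite !mulr0.
  by rewrite leqNgt ltn_ord.
rewrite (_ : cycle_state g t d_gt0 k == cycle_state g t d_gt0 b) ?mul1r; last exact: kb.
move=> /esym/eqP; rewrite exprSr -mulrA -mulrDr mulf_eq0 expf_eq0 => /orP[/andP[_]|].
  by rewrite (inj_eq (@complexI R)) gt_eqF.
rewrite addr_eq0 => /eqP E.
have : p <= t * B.
  rewrite /p E normcN normcM normc_real ?(ltW t_gt0)// ler_wpM2l ?(ltW t_gt0)//.
  by have := growth_prefix_shift (mkseq g k.+1) ac; rewrite size_mkseq; exact: HP.2.
have : t * (2 * (B + 1)) <= p by rewrite -ler_pdivlMr ?mulr_gt0 ?ltr_wpDl// ge_min lexx orbT.
nra.
Qed.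

Lemma walk_nth e0 (x : vertex G) u k : walk x u -> (k < size u)%N ->
  source_of (nth e0 u k) = endpoint x (take k u).
Proof.
elim: u x k => [|e u IH] x [|k] //= /andP[/eqP <-] //.
by move=> wu ku; rewrite (IH (range_of e)).
Qed.

Lemma endpoint_take_nth e0 (x : vertex G) u k : (k < size u)%N ->
  endpoint x (take k.+1 u) = @range_of G (nth e0 u k).
Proof. by move=> ku; rewrite (take_nth e0)// /endpoint map_rcons last_rcons. Qed.

Lemma least_period (g : nat -> edge G) D : (0 < D)%N -> (forall k, g (k + D) = g k) ->
  exists d, [/\ (0 < d)%N, forall k, g (k + d) = g k &
    forall m, (0 < m < d)%N -> exists k, g (k + m) <> g k].
Proof.
move=> D0 gD; pose P m := (0 < m)%N && `[< forall k, g (k + m) = g k >].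
have PD : P D by rewrite /P D0; apply/asboolP.
have [d /andP[d0 /asboolP gd] dmin] := ex_minnP (ex_intro P D PD).
exists d; split=> // m /andP[m0 md]; apply/existsNP => gm.
have := dmin m; rewrite /P m0 => /(_ (introT (asboolP _) gm)).
by rewrite leqNgt md.
Qed.

(** The segment is the beginning of a closed walk at x.  If that walk is empty, a
    single state does; otherwise the block is the cycle of its least period. *)
Lemma strongly_connected_block (x : vertex G) seg (Phi : (word -> C) -> C) c (a : word -> C) :
    walk x seg -> reachable (endpoint x seg) x -> growth c a ->
    Phi (prefix_shift seg a) != 0 ->
  exists (M : automaton R G) (q0 q : state M),
    [/\ tight M, compatible M, weight_positive M, state_separating M &
      strongly_connected M] /\
    [/\ vert q0 = x, vert q = endpoint x seg, forall i : state M, reachable (vert i) x &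
      forall H, exits_at q Phi H -> H q0 a != 0].
Proof.
move=> xseg [ret wret eret] ac Phia.
pose u := seg ++ ret.
have xu : walk x u by rewrite walk_cat xseg.
have eu : endpoint x u = x by rewrite endpoint_cat.
have [u0|] := posnP (size u).
  have [seg0 ret0] : seg = [::] /\ ret = [::].
    by move/size0nil: u0; rewrite /u; case: (seg) (ret) => [|? ?] [].
  exists (vertex_automaton R x), tt, tt; split.
    split; [exact: vertex_tight|exact: vertex_compatible|
      exact: vertex_weight_positive|exact: vertex_separating|
      exact: vertex_strongly_connected].
  split=> [//| |i|H [HE _]]; first by rewrite seg0.
    exact: reachable_refl.
  rewrite (HE tt a c ac) eqxx mul1r big1 ?addr0 => [|[] _]; last by rewrite mul0r.
  by move: Phia; rewrite seg0.
move=> D0; have [e0 _] : exists e0 : edge G, true.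
  by case: (u) D0 => // e0 ? _; exists e0.
(* The closed walk u repeated forever. *)
pose D := size u; pose g k := nth e0 u (k %% D).
have gD k : g (k + D) = g k by rewrite /g modnDr.
have gs k : source_of (g k) = endpoint x (take (k %% D) u).
  by apply: walk_nth => //; rewrite ltn_mod.
have gchain k : range_of (g k) = source_of (g k.+1).
  rewrite gs /g -(endpoint_take_nth e0 x) ?ltn_mod//.
  rewrite -[in RHS]addn1 -modnDml addn1.
  have : ((k %% D).+1 <= D)%N by rewrite ltn_mod.
  rewrite leq_eqVlt => /orP[/eqP ->|kD]; last by rewrite (modn_small kD).
  by rewrite modnn take0 take_size eu.
have [d [d0 gd gmin]] := least_period D0 gD.
pose b := size seg.
have segE : seg = mkseq g b.
  apply: (@eq_from_nth _ e0) => [|k kb]; first by rewrite size_mkseq.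
  rewrite nth_mkseq// /g modn_small; last first.
    by apply: leq_trans kb _; rewrite /D size_cat leq_addr.
  by rewrite nth_cat kb.
have Phig : Phi (prefix_shift (mkseq g b) a) != 0 by rewrite -segE.
have [t [t0 t8 tH]] := cycle_nonvanishing d0 gd ac Phig.
exists (cycle_automaton g d t), (cycle_state g t d0 0), (cycle_state g t d0 b); split.
  split; [exact: cycle_tight|exact: cycle_compatible|exact: cycle_weight_positive|
    exact: cycle_separating|exact: cycle_strongly_connected].
split=> [| |i|]; last exact: tH.
- by rewrite /= mod0n gs mod0n take0.
- rewrite /= (periodic_mod gd) gs.
  have : (b <= D)%N by rewrite /D size_cat leq_addr.
  rewrite leq_eqVlt => /orP[/eqP bD|bD]; last first.
    by rewrite modn_small// /u take_size_cat.
  rewrite bD modnn take0 -[LHS]eu -[u]take_size -/D -bD.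
  by rewrite /u take_size_cat.
- rewrite /= gs; exists (drop (i %% D) u).
    by move: xu; rewrite -{1}(cat_take_drop (i %% D) u) walk_cat => /andP[].
  by rewrite -endpoint_cat cat_take_drop.
Qed.

(** What makes [automaton_rep] a nest representation. *)
Record nest_automaton (M : automaton R G) : Prop := NestAutomaton {
  nest_automaton_contractive : contractive M;
  nest_automaton_compatible : compatible M;
  nest_automaton_positive : weight_positive M;
  nest_automaton_separating : state_separating M;
  nest_automaton_total : total (connect (@arrow R G M)) }.

(** That every state is reached from the initial one serves twice in the
    induction: it makes reachability total on the graft, and it shows that the vertices
    of the tail, all reachable from the next vertex of the word, cannot lie in
    the block. *)
Lemma nonvanishing_automaton (x : vertex G) es c (a : word -> C) :
    walk x es -> growth c a -> a es != 0 ->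
  exists (M : automaton R G) (q0 q1 : state M), nest_automaton M /\
    [/\ vert q0 = x, forall q, connect (@arrow R G M) q0 q & transfer q0 q1 a != 0].
Proof.
have [n] := ubnP (size es); elim: n x es c a => // n IH x es c a.
rewrite ltnS => esn xes ac aes.
pose returns b := (b <= size es)%N && `[< reachable (endpoint x (take b es)) x >].
have r0 : returns 0%N by rewrite /returns take0; apply/asboolP; exact: reachable_refl.
have rle b : returns b -> (b <= size es)%N by case/andP.
(* b is the length of the longest initial segment that can be closed up at x. *)
have [b /andP[bes /asboolP rb] bmax] := ex_maxnP (ex_intro (fun b => returns b) 0%N r0) rle.
have [xseg xrest] : walk x (take b es) /\ walk (endpoint x (take b es)) (drop b es).
  by apply/andP; rewrite -walk_cat cat_take_drop.
case E : (drop b es) xrest => [|e rest] xrest.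
  pose Phi (f : word -> C) := f [::].
  have esE : take b es = es by rewrite -[RHS](cat_take_drop b) E cats0.
  rewrite esE in rb.
  have Phia : Phi (prefix_shift es a) != 0 by rewrite /Phi /prefix_shift cats0.
  have [M [q0 [q [[Mt Mv Mp Ms Mc] [q0x _ _ MH]]]]] :=
    strongly_connected_block xes rb ac Phia.
  have Mc4 := tight_contractive Mt.
  exists M, q0, q; split; first by split=> // i j; rewrite Mc.
  split=> //; apply: (MH (fun i => transfer i q)); split=> i f k fk.
    exact: transfer_unfold.
  exact: transfer_bound.
move: xrest => /= /andP[/eqP se wrest].
pose a' := prefix_shift (rcons (take b es) e) a.
have ag' : growth (2 ^+ size (rcons (take b es) e) * c) a' by exact: growth_prefix_shift.
have a'rest : a' rest != 0.
  by rewrite /a' /prefix_shift cat_rcons -E cat_take_drop.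
have rn : (size rest < n)%N.
  apply: leq_trans esn; rewrite -[in leqRHS](cat_take_drop b es) E size_cat /=.
  by rewrite addnS ltnS leq_addl.
have [M2 [q0' [q1 [M2g [q0'x M2q M2n]]]]] := IH _ _ _ _ rn wrest ag' a'rest.
pose Phi (f : word -> C) := (8^-1 : R)%:C%C * transfer q0' q1 (edge_shift (Some e) f).
have Phia : Phi (prefix_shift (take b es) a) != 0.
  rewrite mulf_eq0 negb_or; apply/andP; split.
    by rewrite (inj_eq (@complexI R)) invr_eq0 pnatr_eq0.
  rewrite (_ : edge_shift _ _ = a')//; apply/funext => s.
  by rewrite /a' /= /prefix_shift cat_rcons.
have [M1 [q0 [q [[M1t M1v M1p M1s M1c] [q0x qx M1x MH]]]]] :=
  strongly_connected_block xseg rb ac Phia.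
case: M2g => M2c M2v M2p M2s M2t.
(* A common vertex would close up the segment of length b + 1. *)
have disj (i : state M1) (j : state M2) : vert i <> vert j.
  move=> ij.
  have ret : reachable (range_of e) x.
    apply: (@reachable_trans _ (vert j)); last by rewrite -ij.
    by rewrite -q0'x; apply: connect_reachable (M2q j).
  have bS : (b < size es)%N by rewrite ltnNge -subn_eq0 -size_drop E.
  have : returns b.+1.
    rewrite /returns bS; apply/asboolP; rewrite -addn1 takeD E /= take0.
    by rewrite endpoint_cat.
  by move=> /bmax; rewrite ltnn.
have qe : source_of e = vert q by rewrite se qx.
have re : range_of e = vert q0' by rewrite q0'x.
exists (graft q q0' e), (@graft_left R G M1 M2 q q0' e q0), (@graft_right R G M1 M2 q q0' e q1); split.
  split; [exact: graft_contractive|exact: graft_compatible|exact: graft_weight_positive|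
    exact: graft_separating|exact: graft_total].
split=> //; first by move=> u; exact: graft_connect_left.
apply: (MH (fun i => transfer (@graft_left R G M1 M2 q q0' e i)
  (@graft_right R G M1 M2 q q0' e q1))); split=> i f k fk.
  exact: transfer_graft.
by apply: transfer_bound => //; exact: graft_contractive.
Qed.

End Nonvanishing.

Theorem theorem4p7 (R : realType) (G : digraph) (A : bop R (gpath G)) :
  free_semigroupoid_algebra R G A -> A <> 0 ->
  exists (n : nat) (rho : bop R (gpath G) -> bop R 'I_n),
    nest_representation (free_semigroupoid_algebra R G) rho /\ rho A <> 0.
Proof.
move=> LA A0; have [x [s [xs As]]] := exists_fourier_neq0 LA A0.
have [M [q0 [q1 [[Mc Mv Mp Ms Mt] [q0x _ q01]]]]] :=
  nonvanishing_automaton xs (fourier_growth A x) (introN eqP As).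
exists #|state M|, (@automaton_rep _ _ M); split; first exact: automaton_rep_nest_representation.
by apply: (@automaton_rep_neq0 _ _ _ _ q0 q1); rewrite /coefficient q0x; apply/eqP.
Qed.
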